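(* Let $p > 2$ be a prime, and let $n \ge 2p$ with $p \mid n$. Then $\lambda := (n-p,p)$ lies in $\mathcal{C}^2_p$, the $p$-rank of $H^2(\Sigma_n,S^\lambda_{\mathbb{Z}})$ is $1$, and $\lambda$ has no predecessor in $\mathcal{C}^2_p$.
   Context: $\Sigma_n$ is the symmetric group on $n$ letters. $S^\lambda_{\mathbb{Z}}$ is the integral Specht module in James' convention (the $\mathbb{Z}\Sigma_n$-submodule of the permutation module on $\lambda$-tabloids spanned by polytabloids, so $S^{(n)}_{\mathbb{Z}}$ is trivial). $\mathcal{C}^2_p := \bigcup_{n \in \mathbb{Z}_{\ge 0}} \{\lambda \vdash n \mid p \text{ divides } |H^2(\Sigma_n,S^\lambda_{\mathbb{Z}})|\}$, where $H^2(\Sigma_n,S^\lambda_{\mathbb{Z}})$ is a finite abelian group. The $p$-rank of a finite abelian group is the number of direct summands $\mathbb{Z}/p\mathbb{Z}$ of its maximal elementary abelian $p$-subgroup. For $\lambda,\mu\in\mathcal{C}^2_p$ such that $\mu$ is obtained from $\lambda$ by adding one node, $\lambda$ is called a predecessor of $\mu$ in $\mathcal{C}^2_p$. *)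

(* Defs.v *)
From HB Require Import structures.
From mathcomp Require Import all_boot all_order all_algebra all_fingroup.
From mathcomp Require Import boolp.

Set Implicit Arguments.
Unset Strict Implicit.
Unset Printing Implicit Defensive.

Import GRing.Theory.
Local Open Scope ring_scope.

(* A left Z[G]-module. *)
Record gModule (G : finGroupType) := GModule {
  gmod_sort :> zmodType;
  gact : G -> gmod_sort -> gmod_sort;
  gact1 : forall x, gact 1%g x = x;
  gactM : forall (g h : G) x, gact (g * h)%g x = gact g (gact h x);
  gactD : forall g x y, gact g (x + y) = gact g x + gact g y
}.

(* H^2(G, M) is computed as 2-cocycles modulo 2-coboundaries of the           *)
(* inhomogeneous bar complex.                                                 *)
Section Cohomology.
Variables (G : finGroupType) (M : gModule G).

Lemma gactB (g : G) (x y : M) : gact g (x - y) = gact g x - gact g y.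
Proof. by apply: (addIr (gact g y)); rewrite -gactD !subrK. Qed.

Definition cobound1 (f : {ffun G -> M}) : {ffun G * G -> M} :=
  [ffun x => let: (g, h) := x in gact g (f h) - f (g * h)%g + f g].

Definition cobound2 (f : {ffun G * G -> M}) : {ffun G * G * G -> M} :=
  [ffun x => let: (g, h, k) := x in
     gact g (f (h, k)) - f (g * h, k)%g + f (g, h * k)%g - f (g, h)].

Lemma cobound1B f1 f2 : cobound1 (f1 - f2) = cobound1 f1 - cobound1 f2.
Proof.
by apply/ffunP=> -[g h]; rewrite !ffunE /= gactB !opprD !opprK
  !addrA [LHS](ACl (1*3*5*2*4*6))%AC.
Qed.

Lemma cobound2B f1 f2 : cobound2 (f1 - f2) = cobound2 f1 - cobound2 f2.
Proof.
by apply/ffunP=> -[[g h] k]; rewrite !ffunE /= gactB !opprD !opprK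
  !addrA [LHS](ACl (1*3*5*7*2*4*6*8))%AC.
Qed.

Lemma cobound21 f : cobound2 (cobound1 f) = 0.
Proof.
apply/ffunP=> -[[g h] k]; rewrite !ffunE /= gactD gactB gactM mulgA.
by rewrite !opprD !opprK !addrA
  [LHS](ACl ((1*4)*(7*2)*(3*10)*(5*8)*(11*6)*(9*12)))%AC /= !subrr !addr0.
Qed.

Definition cocycle2 : {pred {ffun G * G -> M}} := fun f => cobound2 f == 0.

Fact cocycle2_closed : zmod_closed cocycle2.
Proof.
split=> [|f1 f2]; rewrite !unfold_in.
  by have := cobound2B 0 0; rewrite !subrr => ->.
by move=> /eqP f1_0 /eqP f2_0; rewrite cobound2B f1_0 f2_0 subrr.
Qed.
HB.instance Definition _ := GRing.isZmodClosed.Build _ cocycle2 cocycle2_closed.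

Record Z2 := Cocycle2 { z2val : {ffun G * G -> M}; _ : z2val \in cocycle2 }.
HB.instance Definition _ := [isSub for z2val].
HB.instance Definition _ := [Choice of Z2 by <:].
HB.instance Definition _ := [SubChoice_isSubZmodule of Z2 by <:].

Definition coboundary2 : {pred Z2} :=
  fun z => `[< exists f : {ffun G -> M}, val z = cobound1 f >].

Fact coboundary2_closed : zmod_closed coboundary2.
Proof.
split=> [|z1 z2]; rewrite !unfold_in.
  by apply/asboolP; exists 0; have := cobound1B 0 0; rewrite !subrr raddf0 => ->.
move=> /asboolP[f1 z1E] /asboolP[f2 z2E]; apply/asboolP; exists (f1 - f2).
by rewrite raddfB /= cobound1B z1E z2E.
Qed.
HB.instance Definition _ :=
  GRing.isZmodClosed.Build _ coboundary2 coboundary2_closed.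

Definition H2 : zmodType := Quotient.quot coboundary2.

End Cohomology.

(* [finite_order A m] says that A is finite with exactly m elements. *)
Definition finite_order (A : zmodType) (m : nat) : Prop :=
  exists f : 'I_m -> A, bijective f.

Definition elementary_abelian (p : nat) (A : zmodType) (E : zmodClosed A) : Prop :=
  forall x, x \in (E : {pred A}) -> x *+ p = 0.

Definition max_elementary_abelian (p : nat) (A : zmodType) (E : zmodClosed A) : Prop :=
  elementary_abelian p E /\
  forall F : zmodClosed A, elementary_abelian p F ->
    {subset (E : {pred A}) <= (F : {pred A})} ->
    {subset (F : {pred A}) <= (E : {pred A})}.

(* [p_rank_is p A r]: the maximal elementary abelian p-subgroup of A is       *)
(* isomorphic to (Z/p)^r; p is meant to be prime.                             *)
Definition p_rank_is (p : nat) (A : zmodType) (r : nat) : Prop :=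
  exists2 E : zmodClosed A, max_elementary_abelian p E &
  exists2 f : {additive 'rV['F_p]_r -> A}, injective f &
    forall x, x \in (E : {pred A}) <-> exists v, f v = x.

Definition is_partition (n : nat) (la : seq nat) : bool :=
  [&& sorted geq la, 0%N \notin la & sumn la == n].

(* Integral Specht modules.  Rows, columns and letters are numbered from 0;   *)
(* for la a partition of n, row and column numbers of cells are below n.      *)
(* Products in 'S_n are read from left to right, so that precomposition       *)
(* T |-> T \o g is a *left* action: in it, g replaces each letter i by        *)
(* g^-1 i, which is the usual action under g |-> g^-1.                        *)
Section Specht.
Variables (n : nat) (la : seq nat).

Definition diagram : {set 'I_n * 'I_n} := 
  [set c : 'I_n * 'I_n | (c.2 < nth 0 la c.1)%N].

(* A tableau sends each letter to the cell it occupies; for la a partition    *)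
(* of n these injections are exactly the bijections onto the diagram.         *)
Definition is_tableau (T : {ffun 'I_n -> 'I_n * 'I_n}) : bool :=
  injectiveb T && [forall i, T i \in diagram].

Record tableau :=
  Tableau { tabval : {ffun 'I_n -> 'I_n * 'I_n}; _ : is_tableau tabval }.
HB.instance Definition _ := [isSub for tabval].
HB.instance Definition _ := [Finite of tableau by <:].

Fact tableau_act_proof (g : 'S_n) (T : tableau) :
  is_tableau [ffun i => val T (g i)].
Proof.
case/andP: (valP T) => /injectiveP injT /forallP inT; apply/andP; split.
  by apply/injectiveP=> i j; rewrite !ffunE => /injT/perm_inj.
by apply/forallP=> i; rewrite ffunE.
Qed.
Definition tableau_act (g : 'S_n) (T : tableau) : tableau :=
  Sub [ffun i => val T (g i)] (tableau_act_proof g T).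

(* Two tableaux are row equivalent iff each letter lies in the same row of    *)
(* both, so the tabloid {T} is encoded by the function mapping each letter    *)
(* to its row in T.                                                           *)
Definition row_fun (T : tableau) : {ffun 'I_n -> 'I_n} :=
  [ffun i => (val T i).1].

Definition is_tabloid (r : {ffun 'I_n -> 'I_n}) : bool :=
  [exists T : tableau, r == row_fun T].

Record tabloid := Tabloid { rowval : {ffun 'I_n -> 'I_n}; _ : is_tabloid rowval }.
HB.instance Definition _ := [isSub for rowval].
HB.instance Definition _ := [Finite of tabloid by <:].

Fact tabloid_of_proof (T : tableau) : is_tabloid (row_fun T).
Proof. by apply/existsP; exists T. Qed.
Definition tabloid_of (T : tableau) : tabloid :=
  Sub (row_fun T) (tabloid_of_proof T).

Fact tabloid_act_proof (g : 'S_n) (t : tabloid) :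
  is_tabloid [ffun i => val t (g i)].
Proof.
case/existsP: (valP t) => T /eqP ->; apply/existsP; exists (tableau_act g T).
by apply/eqP/ffunP=> i; rewrite !ffunE /= ?ffunE.
Qed.
Definition tabloid_act (g : 'S_n) (t : tabloid) : tabloid :=
  Sub [ffun i => val t (g i)] (tabloid_act_proof g t).

Lemma tabloid_act1 t : tabloid_act 1%g t = t.
Proof. by apply/val_inj/ffunP=> i; rewrite /= !ffunE perm1. Qed.

Lemma tabloid_actM g h t :
  tabloid_act (g * h)%g t = tabloid_act g (tabloid_act h t).
Proof. by apply/val_inj/ffunP=> i; rewrite /= !ffunE permM. Qed.

(* The free Z-module on tabloids, as functions tabloid -> int. *)
Definition tabloid_basis (t : tabloid) : {ffun tabloid -> int} :=
  [ffun u => (u == t)%:R].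

Definition tabloid_mod_act (g : 'S_n) (x : {ffun tabloid -> int}) :
  {ffun tabloid -> int} := [ffun t => x (tabloid_act g^-1%g t)].

Lemma tabloid_mod_act_basis g t :
  tabloid_mod_act g (tabloid_basis t) = tabloid_basis (tabloid_act g t).
Proof.
apply/ffunP=> u; rewrite !ffunE; congr ((_ : bool)%:R).
by apply/eqP/eqP=> [<-|->]; rewrite -tabloid_actM ?mulgV ?mulVg tabloid_act1.
Qed.

Lemma tabloid_mod_act1 x : tabloid_mod_act 1%g x = x.
Proof. by apply/ffunP=> t; rewrite ffunE invg1 tabloid_act1. Qed.

Lemma tabloid_mod_actM g h x :
  tabloid_mod_act (g * h)%g x = tabloid_mod_act g (tabloid_mod_act h x).
Proof. by apply/ffunP=> t; rewrite !ffunE invMg tabloid_actM. Qed.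

Lemma tabloid_mod_actD g x y :
  tabloid_mod_act g (x + y) = tabloid_mod_act g x + tabloid_mod_act g y.
Proof. by apply/ffunP=> t; rewrite !ffunE. Qed.

Fact tabloid_mod_actB g : {morph tabloid_mod_act g : x y / x - y}.
Proof. by move=> x y; apply/ffunP=> t; rewrite !ffunE. Qed.
HB.instance Definition _ g :=
  GRing.isZmodMorphism.Build _ _ (tabloid_mod_act g) (tabloid_mod_actB g).

Definition column_stabilizer (T : tableau) : {set 'S_n} :=
  [set s : 'S_n | [forall i, (val T (s i)).2 == (val T i).2]].

Definition polytabloid (T : tableau) : {ffun tabloid -> int} :=
  \sum_(s in column_stabilizer T)
     tabloid_basis (tabloid_of (tableau_act s T)) *~ (-1) ^+ s.

Lemma tabloid_mod_act_polytabloid g T :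
  tabloid_mod_act g (polytabloid T) = polytabloid (tableau_act g T).
Proof.
rewrite raddf_sum /=.
rewrite (reindex_inj (conjg_inj g)); apply: eq_big => [s|s _].
  rewrite !inE; apply/forallP/forallP => stab i.
    by have := stab (g i); rewrite !ffunE -permM -conjgC permM.
  by have := stab ((g^-1)%g i); rewrite /= !ffunE permKV conjgE !permM.
rewrite raddfMz /= tabloid_mod_act_basis odd_permJ; congr (tabloid_basis _ *~ _).
by apply/val_inj/ffunP=> i; rewrite /= !ffunE -!permM -conjgC.
Qed.

Definition specht_pred : {pred {ffun tabloid -> int}} := fun x =>
  `[< exists c : tableau -> int, x = \sum_(T : tableau) polytabloid T *~ c T >].

Fact specht_closed : zmod_closed specht_pred.
Proof.
split=> [|x y]; rewrite !unfold_in.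
  by apply/asboolP; exists (fun=> 0); rewrite big1.
move=> /asboolP[c ->] /asboolP[d ->]; apply/asboolP.
exists (fun T => c T - d T); rewrite -sumrB.
by apply: eq_bigr => T _; rewrite mulrzBr.
Qed.
HB.instance Definition _ := GRing.isZmodClosed.Build _ specht_pred specht_closed.

Record specht_sort :=
  SpechtElt { spval : {ffun tabloid -> int}; _ : spval \in specht_pred }.
HB.instance Definition _ := [isSub for spval].
HB.instance Definition _ := [Choice of specht_sort by <:].
HB.instance Definition _ := [SubChoice_isSubZmodule of specht_sort by <:].

Fact specht_act_proof (g : 'S_n) (x : specht_sort) :
  tabloid_mod_act g (val x) \in specht_pred.
Proof.
case/asboolP: (valP x) => c ->; apply/asboolP.
exists (fun T => c (tableau_act g^-1%g T)).
have actK : cancel (tableau_act g^-1%g) (tableau_act g).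
  by move=> T; apply/val_inj/ffunP=> i; rewrite /= !ffunE -permM mulgV perm1.
have actVK : cancel (tableau_act g) (tableau_act g^-1%g).
  by move=> T; apply/val_inj/ffunP=> i; rewrite /= !ffunE -permM mulVg perm1.
rewrite raddf_sum [RHS](reindex_inj (can_inj actVK)) /=.
apply: eq_bigr => T _; rewrite raddfMz /= actVK.
by rewrite tabloid_mod_act_polytabloid.
Qed.
Definition specht_act (g : 'S_n) (x : specht_sort) : specht_sort :=
  Sub (tabloid_mod_act g (val x)) (specht_act_proof g x).

Fact specht_act1 x : specht_act 1%g x = x.
Proof. exact/val_inj/tabloid_mod_act1. Qed.

Fact specht_actM (g h : 'S_n) x :
  specht_act (g * h)%g x = specht_act g (specht_act h x).
Proof. exact/val_inj/tabloid_mod_actM. Qed.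

Fact specht_actD g x y : specht_act g (x + y) = specht_act g x + specht_act g y.
Proof. exact/val_inj/tabloid_mod_actD. Qed.

Definition specht : gModule 'S_n := GModule specht_act1 specht_actM specht_actD.

End Specht.

Definition in_C2 (p : nat) (la : seq nat) : Prop :=
  exists n : nat, is_partition n la /\
    exists2 m, finite_order (H2 (specht n la)) m & (p %| m)%N.

Definition add_node (la mu : seq nat) : Prop := exists i, mu = incr_nth la i.

Definition predecessor (p : nat) (la mu : seq nat) : Prop :=
  [/\ in_C2 p la, in_C2 p mu & add_node la mu].

(* Main.v *)
From HB Require Import structures.
From mathcomp Require Import all_boot all_order all_algebra all_fingroup.
From mathcomp Require Import all_solvable.
From mathcomp Require Import zify ring.
From mathcomp Require Import boolp.
Require Import Defs.

Set Implicit Arguments.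
Unset Strict Implicit.
Unset Printing Implicit Defensive.

(** Notation for this overview: M_j is the lattice of integer functions on the
    j-element subsets of the n letters, and down : M_k -> M_(k-1) sends f to the
    function whose value at A is the sum of f over the k-sets containing A.

    For 2k <= n the Specht module S of (n-k, k) is the kernel of down on M_k
    ([down_to_sets], [to_sets_image]); the hard inclusion is that the kernel is
    spanned over the integers by products of differences of letters
    ([kernel_down_span]).  Permutation modules on subsets have H^1 and H^2
    killed by 2, because the stabilizers are generated by involutions
    ([crossed_hom], [crossed_cocycle]).  Hence, at an odd prime p, the sequence
    0 -> S -> M_k -> down(M_k) -> 0 identifies H^2(S) with H^1(down(M_k)), and
    0 -> down(M_k) -> M_(k-1) -> M_(k-1)/down(M_k) -> 0 identifies the latter
    with the cokernel of the map from the invariants of M_(k-1), which are the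
    constants, to the invariants of M_(k-1)/down(M_k).

    At p this quotient vanishes when k < p, and for k = p it is Z/p through
    the total of the values of a function ([image_factorial],
    [image_total_dvd]).  So for k = p the p-part of H^2(S) is the cokernel of
    multiplication by binomial(n, p-1) from Z to Z/p.  This binomial
    coefficient is divisible by p when p divides n, which gives a group of
    order p for (n-p, p) ([H2_generator]); it is prime to p when p divides n+1
    ([H2_no_torsion_pred]).  The partitions from which (n-p, p) arises by
    adding a node are (n-p, p-1) and (n-p-1, p), of n-1; the cases k = p-1
    and k = p with p dividing (n-1)+1 show that neither has p-torsion.

    The argument is carried out with explicit cocycles, and localization at p
    is replaced by multiplication with integers prime to p.  Finiteness of
    H^2(S) comes from its being killed by the order of the group together with
    the saturation of S in M_k ([H2_finite]). *)

(** * Functions on finite sets of letters *)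

Section SetFunctions.
Import GRing.Theory Num.Theory.
Local Open Scope ring_scope.
Variable n : nat.
Local Notation V := {ffun {set 'I_n} -> int}.

Lemma imset_perm1 (B : {set 'I_n}) : (1%g : 'S_n) @: B = B.
Proof. by rewrite -[RHS]imset_id; apply: eq_imset => i; rewrite perm1. Qed.

Lemma imset_permM (g h : 'S_n) (B : {set 'I_n}) : (g * h)%g @: B = h @: (g @: B).
Proof. by rewrite -imset_comp; apply: eq_imset => i; rewrite permM. Qed.

Definition set_act (R : zmodType) (g : 'S_n) (f : {ffun {set 'I_n} -> R}) :
  {ffun {set 'I_n} -> R} := [ffun B : {set 'I_n} => f (g @: B)].

Fact set_act_is_zmod_morphism R g : {morph @set_act R g : x y / x - y}.
Proof. by move=> x y; apply/ffunP=> t; rewrite !ffunE. Qed.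
HB.instance Definition _ R g :=
  GRing.isZmodMorphism.Build _ _ (@set_act R g) (@set_act_is_zmod_morphism R g).

Lemma set_actM (R : zmodType) (g h : 'S_n) (f : {ffun {set 'I_n} -> R}) :
  set_act (g * h)%g f = set_act g (set_act h f).
Proof. by apply/ffunP=> B; rewrite !ffunE imset_permM. Qed.

(** Identifying a set of letters with a squarefree monomial, this is the sum of
    all partial derivatives. *)
Definition down (f : V) : V := [ffun A : {set 'I_n} => \sum_(b | b \notin A) f (b |: A)].

Fact down_is_zmod_morphism : {morph down : x y / x - y}.
Proof.
move=> x y; apply/ffunP=> A; rewrite !ffunE -sumrB.
by apply: eq_bigr => b _; rewrite !ffunE.
Qed.
HB.instance Definition _ :=
  GRing.isZmodMorphism.Build _ _ down down_is_zmod_morphism.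

Lemma down_act g f : down (set_act g f) = set_act g (down f).
Proof.
apply/ffunP=> A; rewrite !ffunE [RHS](reindex_inj (@perm_inj _ g)) /=.
apply: eq_big => [b|b _]; first by rewrite (mem_imset _ _ (@perm_inj _ g)).
by rewrite !ffunE imsetU1.
Qed.

Definition homog k (f : V) := forall B : {set 'I_n}, #|B| != k -> f B = 0.

Lemma homog0 k : homog k 0.
Proof. by move=> B _; rewrite ffunE. Qed.

Lemma homogB k f1 f2 : homog k f1 -> homog k f2 -> homog k (f1 - f2).
Proof. by move=> h1 h2 B nB; rewrite !ffunE h1 ?h2 ?subrr. Qed.

Lemma homogD k f1 f2 : homog k f1 -> homog k f2 -> homog k (f1 + f2).
Proof. by move=> h1 h2 B nB; rewrite !ffunE h1 ?h2 ?addr0. Qed.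

Lemma homogMn k f m : homog k f -> homog k (f *+ m).
Proof. by move=> h B nB; rewrite ffunMnE h ?mul0rn. Qed.

Lemma ffunMzE (T : finType) (W : zmodType) (f : {ffun T -> W}) z B : (f *~ z) B = f B *~ z.
Proof. by case: z => m; rewrite ?NegzE ?mulrNz ?ffunE ffunMnE. Qed.

Lemma homogMz k f z : homog k f -> homog k (f *~ z).
Proof. by move=> h B nB; rewrite ffunMzE h ?mul0rz. Qed.

Lemma homog_act k g f : homog k f -> homog k (set_act g f).
Proof. by move=> h B nB; rewrite ffunE h // card_imset //; exact: perm_inj. Qed.

Lemma homog_down k f : homog k.+1 f -> homog k (down f).
Proof.
move=> h A nA; rewrite ffunE big1 // => b bA; apply: h.
by rewrite cardsU1 bA.
Qed.

Definition homog_part k (f : V) : V := [ffun B : {set 'I_n} => f B *+ (#|B| == k)].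

Lemma homog_partP k f : homog k (homog_part k f).
Proof. by move=> B /negbTE nB; rewrite ffunE nB. Qed.

Lemma homog_part_id k f : homog k f -> homog_part k f = f.
Proof.
by move=> h; apply/ffunP=> B; rewrite ffunE; case: eqP => [|/eqP/h->].
Qed.

Fact homog_part_is_zmod_morphism k : {morph homog_part k : x y / x - y}.
Proof. by move=> x y; apply/ffunP=> A; rewrite !ffunE mulrnBl. Qed.
HB.instance Definition _ k :=
  GRing.isZmodMorphism.Build _ _ (homog_part k) (@homog_part_is_zmod_morphism k).

Lemma homog_part_act k g f : homog_part k (set_act g f) = set_act g (homog_part k f).
Proof. by apply/ffunP=> B; rewrite !ffunE card_imset //; exact: perm_inj. Qed.

Definition set_basis (A : {set 'I_n}) : V := [ffun B : {set 'I_n} => (B == A)%:R].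

Lemma homog_basis (A : {set 'I_n}) : homog #|A| (set_basis A).
Proof. by move=> B; rewrite ffunE; case: (B =P A) => [->|]; rewrite ?eqxx. Qed.

Definition total (f : V) : int := \sum_B f B.

Fact total_is_zmod_morphism : {morph total : x y / x - y}.
Proof. by move=> x y; rewrite /total -sumrB; apply: eq_bigr => B _; rewrite !ffunE. Qed.
HB.instance Definition _ :=
  GRing.isZmodMorphism.Build _ _ total total_is_zmod_morphism.

Lemma total_act g f : total (set_act g f) = total f.
Proof.
rewrite /total [RHS](reindex_inj (imset_inj (@perm_inj _ g))) /=.
by apply: eq_bigr => B _; rewrite ffunE.
Qed.

Lemma total_basis (A : {set 'I_n}) : total (set_basis A) = 1.
Proof.
rewrite /total (bigD1 A) //= ffunE eqxx big1 ?addr0 // => B /negbTE nB.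
by rewrite ffunE nB.
Qed.

(** Summation by parts: removing a letter is adjoint to [down], since both sides
    run over the pairs made of a set and one of its letters. *)
Lemma down_adjoint (q : {set 'I_n} -> int) f :
  \sum_A q A * down f A = \sum_B f B * \sum_(b in B) q (B :\ b).
Proof.
under eq_bigr do rewrite ffunE big_distrr /=.
under [RHS]eq_bigr do rewrite big_distrr /=.
rewrite (exchange_big_dep predT) //= [RHS](exchange_big_dep predT) //=.
apply: eq_bigr => b _.
rewrite (reindex_onto (fun B => B :\ b) (fun A => b |: A)) /=; last first.
  by move=> A bA; rewrite setU1K.
apply: eq_big => [B|B /andP[_ /eqP bB]].
  rewrite !inE eqxx /=; apply/eqP/idP => [<-|/setD1K //]; exact: setU11.
by rewrite mulrC bB.
Qed.

Lemma total_down k f : homog k f -> total (down f) = total f *+ k.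
Proof.
move=> hf; have := down_adjoint (fun=> 1) f.
under eq_bigr do rewrite mul1r.
rewrite /total => ->; rewrite -sumrMnl; apply: eq_bigr => B _.
case: (altP (#|B| =P k)) => [<-|/hf->]; last by rewrite mul0r mul0rn.
by rewrite sumr_const mulr_natr.
Qed.

Definition reduce (N : nat) (f : {ffun {set 'I_n} -> int}) : {ffun {set 'I_n} -> 'Z_N} :=
  [ffun B : {set 'I_n} => (f B)%:~R].

Fact reduce_is_zmod_morphism N : {morph reduce N : x y / x - y}.
Proof. by move=> x y; apply/ffunP=> B; rewrite !ffunE raddfB. Qed.
HB.instance Definition _ N :=
  GRing.isZmodMorphism.Build _ _ (reduce N) (reduce_is_zmod_morphism N).

(** For a two-row shape the second row determines the tabloid. *)
Definition rowset la (t : tabloid n la) : {set 'I_n} :=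
  [set i | (val t i : nat) == 1%N].

Definition to_sets la (x : specht_sort n la) : V :=
  [ffun B : {set 'I_n} => \sum_(t | rowset t == B) val x t].

Fact to_sets_is_zmod_morphism la : {morph @to_sets la : x y / x - y}.
Proof.
move=> x y; apply/ffunP=> B; rewrite !ffunE -sumrB; apply: eq_bigr => t _.
by rewrite raddfB !ffunE.
Qed.
HB.instance Definition _ la :=
  GRing.isZmodMorphism.Build _ _ (@to_sets la) (@to_sets_is_zmod_morphism la).

(** The signs and factorials are chosen so that [weight_rec] holds: it makes
    consecutive contributions cancel when a letter is added to or removed from a
    set meeting a fixed set in [j] elements. *)
Definition weight d j : int := (-1) ^+ (d - j) * (j`! * (d - j)`!)%:R.

Lemma weight_rec d j : (j < d)%N ->
  weight d j.+1 *+ (d - j) + weight d j *+ j.+1 = 0.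
Proof.
move=> lt_jd; rewrite /weight.
have -> : (d - j = (d - j.+1).+1)%N by lia.
rewrite -[X in X + _]mulr_natr -[X in _ + X]mulr_natr !factS exprS !natrM; ring.
Qed.

Lemma weight_top d : weight d d *+ d.+1 = (d.+1)`!%:R.
Proof. by rewrite /weight subnn expr0 mul1r fact0 muln1 -mulrnA mulnC -factS. Qed.

(** A column of an inverse, up to a factorial, of the square matrix of [down]
    between the subsets of sizes [d + 1] and [d] of a set of size [2 * d + 1]. *)
Definition inverse_column (A W : {set 'I_n}) : V :=
  [ffun B : {set 'I_n} => weight #|A| #|B :&: A| *+ ((B \subset W) && (#|B| == #|A|.+1))].

Lemma homog_inverse_column (A W : {set 'I_n}) : homog #|A|.+1 (inverse_column A W).
Proof. by move=> B /negbTE nB; rewrite ffunE nB andbF. Qed.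

(** At a [d]-set [A'] meeting [A] in [i] elements, the letters to be added are
    [d - i] letters of [A] and [i + 1] letters outside [A], so the value is the
    left-hand side of [weight_rec], unless [A' = A]. *)
Lemma down_inverse_column (A W : {set 'I_n}) :
  A \subset W -> #|W| = (2 * #|A| + 1)%N ->
  down (inverse_column A W) = set_basis A *+ (#|A|.+1)`!.
Proof.
move=> sAW cW; apply/ffunP=> A'; rewrite !ffunE ffunMnE ffunE.
case: (altP (#|A'| =P #|A|)) => [cA'|nA']; last first.
  rewrite big1 => [|b bA']; last first.
    by rewrite ffunE cardsU1 bA' add1n eqSS (negbTE nA') andbF.
  by case: (A' =P A) nA' => [->|]; rewrite ?eqxx ?mul0rn.
case: (boolP (A' \subset W)) => [sA'W|nA']; last first.
  rewrite big1 => [|b bA']; last first.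
    by rewrite ffunE subUset (negbTE nA') andbF.
  by case: (A' =P A) nA' => [->|]; rewrite ?sAW ?mul0rn.
set d := #|A|; set i := #|A' :&: A|.
have le_id : (i <= d)%N by rewrite subset_leq_card ?subsetIr.
rewrite (bigID (mem A)) /=.
rewrite (eq_bigr (fun=> weight d i.+1)); last first.
  move=> b /andP[bA' bA]; rewrite ffunE subUset sA'W sub1set (subsetP sAW) //.
  rewrite cardsU1 bA' cA' eqxx mulr1n; congr weight.
  rewrite setIUl (setIidPl _) ?sub1set // cardsU1 inE (negbTE bA') //.
rewrite sumr_const.
have -> : #|[pred b | (b \notin A') && (b \in A)]| = (d - i)%N.
  rewrite /d /i setIC -cardsD -[RHS]cardsE; apply: eq_card => b.
  by rewrite !inE.
rewrite (bigID (mem W)) /= [X in _ + (_ + X)]big1 ?addr0; last first.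
  by move=> b /andP[_ bW]; rewrite ffunE subUset sub1set (negbTE bW).
rewrite (eq_bigr (fun=> weight d i)); last first.
  move=> b /andP[/andP[bA' bA] bW]; rewrite ffunE subUset sA'W sub1set bW.
  rewrite cardsU1 bA' cA' eqxx mulr1n; congr weight.
  rewrite setIUl (_ : [set b] :&: A = set0) ?set0U //.
  by apply/setP=> x; rewrite !inE; apply/negP => /andP[/eqP-> xA]; rewrite xA in bA.
rewrite sumr_const.
have -> : #|[pred b | ((b \notin A') && (b \notin A)) && (b \in W)]| = i.+1.
  have -> : #|[pred b | ((b \notin A') && (b \notin A)) && (b \in W)]|
         = #|W :\: (A' :|: A)|.
    by apply: eq_card => b; rewrite !inE negb_or.
  rewrite cardsD (setIidPr _) ?subUset ?sA'W ?sAW // cardsU cW cA'.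
  rewrite -/i -/d; lia.
case: eqP => [eA|nA].
  have -> : i = d by rewrite /i eA setIid.
  by rewrite subnn mulr0n add0r weight_top.
rewrite mul0rn; apply: weight_rec; rewrite ltn_neqAle le_id andbT.
apply/negP=> /eqP ei; apply: nA; apply/eqP; rewrite eqEcard cA' leqnn andbT.
suff /eqP <- : A' :&: A == A' by exact: subsetIr.
by rewrite eqEcard subsetIl cA' -/i ei leqnn.
Qed.

(** Pairing [f] with the weights attached to a set [B] isolates [f B] up to a
    factorial, by the same recursion as for [inverse_column].  Besides that of [B], the
    only coefficient that the recursion does not kill is that of a set disjoint
    from [B], and [W] is too small to contain one. *)
Lemma down_injective d (W : {set 'I_n}) f :
  homog d.+1 f -> (forall B : {set 'I_n}, f B != 0 -> B \subset W) ->
  (#|W| < 2 * d.+1)%N ->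
  down f = 0 -> f = 0.
Proof.
move=> hf sW cW df0; apply/ffunP=> B; rewrite [RHS]ffunE.
apply/eqP; apply: contraT => fB.
have cB : #|B| = d.+1 by apply/eqP; apply: contraNT fB => /hf/eqP.
pose q A := weight d #|B :&: A|.
have /eqP := down_adjoint q f.
rewrite df0 big1 => [|A _]; last by rewrite ffunE mulr0.
rewrite (bigD1 B) //= [X in _ + X]big1 ?addr0; last first.
  move=> B' nB'; case: (altP (f B' =P 0)) => [->|fB']; first by rewrite mul0r.
  have cB' : #|B'| = d.+1 by apply/eqP; apply: contraNT fB' => /hf/eqP.
  apply/eqP; rewrite mulf_eq0 (negbTE fB') /=; apply/eqP.
  set i := #|B :&: B'|.
  have ltid : (i < d.+1)%N.
    rewrite ltn_neqAle -{2}cB subset_leq_card ?subsetIl // andbT.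
    apply: contraNneq nB' => ei; rewrite eq_sym eqEcard cB cB' leqnn andbT.
    suff /eqP <- : B :&: B' == B by exact: subsetIr.
    by rewrite eqEcard subsetIl cB -/i ei leqnn.
  have i_gt0 : (0 < i)%N.
    have := cardsU B B'; rewrite cB cB' -/i.
    have := subset_leq_card (_ : B :|: B' \subset W).
    rewrite subUset !sW // => /(_ isT); lia.
  rewrite (bigID (mem B)) /=.
  rewrite (eq_bigr (fun=> weight d i.-1)); last first.
    move=> b /andP[bB' bB]; rewrite /q; congr weight.
    by rewrite setIDA /i (cardsD1 b (B :&: B')) inE bB bB'.
  rewrite [X in _ + X](eq_bigr (fun=> weight d i)); last first.
    move=> b /andP[bB' bB]; rewrite /q; congr weight.
    rewrite setIDA /i (cardsD1 b (B :&: B')) inE (negbTE bB) //.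
  rewrite !sumr_const.
  have -> : #|[pred b | (b \in B') && (b \in B)]| = i.
    by apply: eq_card => b; rewrite !inE andbC.
  have -> : #|[pred b | (b \in B') && (b \notin B)]| = (d - i.-1)%N.
    have -> : #|[pred b | (b \in B') && (b \notin B)]| = #|B' :\: B|.
      by apply: eq_card => b; rewrite !inE andbC.
    rewrite cardsD cB' setIC -/i; lia.
  by rewrite addrC; have := @weight_rec d i.-1; rewrite prednK // => ->; lia.
rewrite (eq_bigr (fun=> weight d d)); last first.
  move=> b bB; rewrite /q; congr weight.
  by rewrite (setIidPr _) ?subD1set //; have := cardsD1 b B; rewrite bB cB => -[].
rewrite sumr_const cB weight_top eq_sym mulf_eq0 (negbTE fB) /=.
by rewrite pnatr_eq0 -leqn0 leqNgt fact_gt0.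
Qed.

(** Multiplication by the difference of letters [a] - [b], in the ring of
    polynomials modulo the squares of the letters; it is used only on functions
    supported on the sets avoiding [a] and [b]. *)
Definition mul_diff (a b : 'I_n) (f : V) : V :=
  [ffun B : {set 'I_n} => ((a \in B)%:R - (b \in B)%:R) * f (B :\ a :\ b)].

Lemma homog_mul_diff k a b f : homog k f -> homog k.+1 (mul_diff a b f).
Proof.
move=> hf B nB; rewrite ffunE.
case aB: (a \in B); case bB: (b \in B); rewrite ?subrr ?mul0r //.
  rewrite hf ?mulr0 //; move: nB.
  by rewrite (cardsD1 a B) (cardsD1 b (B :\ a)) !inE aB bB andbF eqSS.
have nba : b != a by apply: contraTneq bB => ->; rewrite aB.
rewrite hf ?mulr0 //; move: nB.
by rewrite (cardsD1 a B) (cardsD1 b (B :\ a)) !inE aB bB nba.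
Qed.

(** The two derivatives of the difference [a] - [b] cancel, so [down] commutes
    with multiplication by it. *)
Lemma down_mul_diff a b (f : V) : a != b ->
  (forall B : {set 'I_n}, (a \in B) || (b \in B) -> f B = 0) ->
  down (mul_diff a b f) = mul_diff a b (down f).
Proof.
move=> nab f0; apply/ffunP=> A; rewrite !ffunE.
have nba : (b == a) = false by rewrite eq_sym (negbTE nab).
have other c : c \notin A -> c != a -> c != b -> mul_diff a b f (c |: A) =
    ((a \in A)%:R - (b \in A)%:R) * f (c |: (A :\ a :\ b)).
  move=> cA ca cb; rewrite ffunE !inE eq_sym (negbTE ca) eq_sym (negbTE cb) /=.
  congr (_ * f _); apply/setP=> x; rewrite !inE.
  case: (x =P c) => [->|_]; rewrite ?ca ?cb //=.
case aA: (a \in A); case bA: (b \in A).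
- rewrite subrr mul0r big1 // => c cA; rewrite other ?aA ?bA ?subrr ?mul0r //.
    by apply: contraNneq cA => ->; rewrite aA.
  by apply: contraNneq cA => ->; rewrite bA.
- rewrite subr0 mul1r (bigD1 b) ?bA //= ffunE !inE eqxx (negbTE nab) aA subrr mul0r add0r.
  rewrite [RHS](bigD1 a) ?inE ?eqxx ?andbF //= f0 ?setU11 // add0r.
  rewrite [RHS](bigD1 b) ?inE ?eqxx ?nba //= f0 ?setU11 ?orbT // add0r.
  apply: eq_big => [c|c /andP[cA cb]]; last first.
    rewrite other // ?aA ?bA ?subr0 ?mul1r //.
    by apply: contraNneq cA => ->; rewrite aA.
  rewrite !inE; case: (c =P a) => [->|_] /=; first by rewrite aA andbF.
  by case: (c == b); rewrite /= ?andbF ?andbT.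
- rewrite sub0r mulN1r (bigD1 a) ?aA //= ffunE !inE eqxx nba bA subrr mul0r add0r.
  rewrite [in RHS](bigD1 a) ?inE ?eqxx ?andbF //= f0 ?setU11 // add0r.
  rewrite [in RHS](bigD1 b) ?inE ?eqxx ?nba //= f0 ?setU11 ?orbT // add0r -sumrN.
  apply: eq_big => [c|c /andP[cA ca]]; last first.
    rewrite other // ?aA ?bA ?sub0r ?mulN1r //.
    by apply: contraNneq cA => ->; rewrite bA.
  rewrite !inE; case: (c =P b) => [->|_] /=; first by rewrite bA andbF.
  by case: (c == a); rewrite /= ?andbF ?andbT.
rewrite subr0 mul0r (bigD1 a) ?aA //= (bigD1 b) ?bA ?nba //= !ffunE !inE.
rewrite !eqxx nba (negbTE nab) aA bA /= sub0r subr0 mul1r mulN1r big1 => [|c].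
  rewrite addr0; apply/eqP; rewrite subr_eq0; apply/eqP; congr (f _).
  apply/setP=> x; rewrite !inE.
  case: (x =P a) => [->|_]; first by rewrite aA /= !andbF.
  by case: (x =P b) => [->|_] //=; rewrite bA.
by case/andP=> /andP[cA ca] cb; rewrite other ?aA ?bA ?subrr ?mul0r.
Qed.

(** Sets of equal size are connected by exchanges of one letter. *)
Lemma swap_ind (P : {set 'I_n} -> Prop) (A0 : {set 'I_n}) :
  P A0 ->
  (forall (A : {set 'I_n}) a b, #|A| = #|A0| -> a \in A -> b \notin A ->
     P A -> P (b |: (A :\ a))) ->
  forall A : {set 'I_n}, #|A| = #|A0| -> P A.
Proof.
move=> P0 step A cA; have [m] := ubnP #|A :\: A0|.
elim: m A cA => // m IH A cA; rewrite ltnS => le_m.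
case: (boolP (A \subset A0)) => [sA|].
  by have /eqP -> : A == A0 by rewrite eqEcard sA cA leqnn.
case/subsetPn=> b bA bA0.
have : ~~ (A0 \subset A).
  apply: contra bA0 => sA; suff /eqP -> : A0 == A by [].
  by rewrite eqEcard sA cA leqnn.
case/subsetPn=> a aA0 aA.
have nab : a != b by apply: contraNneq aA => ->.
have cB : #|a |: (A :\ b)| = #|A0|.
  by rewrite cardsU1 !inE (negbTE aA) andbF -cA (cardsD1 b A) bA.
have -> : A = b |: ((a |: (A :\ b)) :\ a).
  apply/setP=> x; rewrite !inE.
  case: (x =P b) => [->|_] //=; case: (x =P a) => [->|_] //=.
  by rewrite (negbTE aA).
apply: step => //; rewrite ?setU11 //.
  by rewrite !inE eqxx orbF eq_sym.
apply: IH => //; apply: leq_trans le_m; apply: proper_card; apply/properP.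
split; last by exists b; rewrite !inE ?bA ?bA0 // eqxx eq_sym (negbTE nab).
apply/subsetP=> x; rewrite !inE => /andP[xA0].
by case: (x =P a) => [xa|_] /=; [rewrite xa aA0 in xA0 | rewrite xA0 => /andP[]].
Qed.

Definition const_on k : V := [ffun B : {set 'I_n} => (#|B| == k)%:R].

Lemma const_on_act g k : set_act g (const_on k) = const_on k.
Proof. by apply/ffunP=> B; rewrite !ffunE card_imset //; exact: perm_inj. Qed.

Lemma homog_const_on k : homog k (const_on k).
Proof. by move=> B /negbTE nB; rewrite ffunE nB. Qed.

Lemma total_const_on k : total (const_on k) = 'C(n, k)%:R.
Proof.
rewrite /total -[in RHS](card_ord n) -card_draws -sum1_card natr_sum.
rewrite [RHS]big_mkcond /=; apply: eq_bigr => B _; rewrite ffunE inE.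
by case: eqP.
Qed.

Lemma invariant_const k f : homog k f -> (forall g, set_act g f = f) ->
  exists c, f = const_on k *~ c.
Proof.
move=> hf inv; case: (altP (f =P 0)) => [->|nf]; first by exists 0; rewrite mulr0z.
have [A0 fA0] : exists A0, f A0 != 0.
  apply/existsP; rewrite -[[exists _, _]]negbK negb_exists; apply: contra nf.
  move/forallP=> f0; apply/eqP/ffunP=> B; rewrite ffunE; apply/eqP.
  by rewrite -[_ == _]negbK f0.
have cA0 : #|A0| = k by apply/eqP; apply: contraNT fA0 => /hf/eqP.
exists (f A0); apply/ffunP=> A; rewrite ffunMzE ffunE.
case: eqP => [cA|/eqP/hf->]; last by rewrite mul0rz.
rewrite -mulrzl mulr1 intz; rewrite -cA0 in cA.
move: A cA; apply: swap_ind => // A a b _ aA bA <-.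
rewrite -[in RHS](inv (tperm a b)) ffunE; congr (f _).
have nab : a != b by apply: contraNneq bA => <-.
apply/setP=> x; rewrite -[x](tpermK a b) (mem_imset _ _ (@perm_inj _ _)) !inE.
case: tpermP => [->|->|/eqP xa /eqP xb];
  rewrite ?eqxx ?aA ?(negbTE bA) ?(negbTE nab) ?andbF //.
by rewrite xa (negbTE xb).
Qed.

Lemma set_of_card d : (d <= n)%N -> exists A : {set 'I_n}, #|A| = d.
Proof.
rewrite -[n in (d <= n)%N]card_ord -cardsT => /card_geqP[s [us <- _]].
by exists [set x in s]; rewrite cardsE; apply/card_uniqP.
Qed.

(** The support condition leaves letters free for a later multiplication by a
    difference. *)
Lemma image_basis (A Z : {set 'I_n}) : A \subset Z -> (2 * #|A| + 1 <= #|Z|)%N ->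
  exists2 x, homog #|A|.+1 x /\ (forall B : {set 'I_n}, ~~ (B \subset Z) -> x B = 0) &
    down x = set_basis A *+ (#|A|.+1)`!.
Proof.
move=> sAZ le_Z.
have [U sU cU] : exists2 U : {set 'I_n}, U \subset Z :\: A & #|U| = #|A|.+1.
  have /card_geqP[s [us <- sA]] : (#|A|.+1 <= #|Z :\: A|)%N.
    by rewrite cardsD (setIidPr sAZ); lia.
  exists [set x in s]; last by rewrite cardsE; apply/card_uniqP.
  by apply/subsetP=> x; rewrite inE => /sA.
have dAU : [disjoint A & U].
  by rewrite disjoint_sym disjoints_subset (subset_trans sU) // setDE subsetIr.
have sUZ : U \subset Z by rewrite (subset_trans sU) // subsetDl.
exists (inverse_column A (A :|: U)).
  split; first exact: homog_inverse_column.
  move=> B nB; rewrite ffunE (_ : B \subset _ = false) //.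
  by apply: contraNF nB => /subset_trans; apply; rewrite subUset sAZ.
rewrite down_inverse_column ?subsetUl // cardsU cU disjoint_setI0 // cards0; lia.
Qed.

(** The difference of the two basis vectors is the monomial [C] of the letters of
    [A] other than [a], times [a] - [b].  Applying [image_basis] to [C], away from
    [a] and [b], and multiplying the solution by [a] - [b] costs only the factorial
    [#|A|`!] instead of [(#|A|.+1)`!]. *)
Lemma image_swap (A : {set 'I_n}) (a b : 'I_n) : a \in A -> b \notin A ->
  (2 * #|A| + 1 <= n)%N ->
  exists2 x, homog #|A|.+1 x & down x = (set_basis A - set_basis (b |: (A :\ a))) *+ #|A|`!.
Proof.
move=> aA bA le_n; have nab : a != b by apply: contraNneq bA => <-.
have nba : b != a by rewrite eq_sym.
set C := A :\ a; have cA : #|A| = #|C|.+1 by rewrite (cardsD1 a) aA.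
have sC : C \subset ~: [set a; b].
  apply/subsetP=> x; rewrite !inE => /andP[xa xA]; rewrite (negbTE xa) /=.
  by apply: contraNneq bA => <-.
have aC : a \in C = false by rewrite !inE eqxx.
have bC : b \in C = false by rewrite !inE (negbTE bA) andbF.
have eA : A = a |: C by rewrite setD1K.
clearbody C.
have [|x [hx sx] dx] := image_basis sC.
  move: le_n (cardsC [set a; b]); rewrite cards2 nab card_ord cA /=.
  by move: #|C| #|~: _|; lia.
have x0 (B : {set 'I_n}) : (a \in B) || (b \in B) -> x B = 0.
  move=> abB; apply: sx; apply/negP => /subsetP sB.
  by case/orP: abB => /sB; rewrite !inE eqxx ?orbT.
exists (mul_diff a b x); first by rewrite cA; apply: homog_mul_diff.
rewrite down_mul_diff // dx -cA; apply/ffunP=> B.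
rewrite !(ffunE, ffunMnE) mulrnAr; congr (_ *+ _).
rewrite eA.
case aB: (a \in B); case bB: (b \in B); rewrite ?subrr ?sub0r ?subr0 ?mul0r ?mulN1r ?mul1r.
- have /negbTE -> : B != a |: C.
    by apply: contraTneq bB => ->; rewrite !inE (negbTE nba) bC.
  have /negbTE -> : B != b |: C.
    by apply: contraTneq aB => ->; rewrite !inE (negbTE nab) aC.
  by rewrite subrr.
- have /negbTE -> : B != b |: C by apply: contraFneq bB => ->; rewrite setU11.
  rewrite subr0; congr ((_ : bool)%:R); apply/eqP/eqP => [eC|->].
    rewrite -eC; apply/setP=> y; rewrite !inE.
    case: (y =P a) => [->|_]; first by rewrite aB.
    by case: (y =P b) => [->|_] //=; rewrite bB.
  by rewrite setU1K ?aC //; apply/setDidPl; rewrite disjoint_sym disjoints1 bC.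
- have /negbTE -> : B != a |: C by apply: contraFneq aB => ->; rewrite setU11.
  rewrite sub0r; congr (- (_ : bool)%:R); apply/eqP/eqP => [eC|->].
    rewrite -eC; apply/setP=> y; rewrite !inE.
    case: (y =P b) => [->|_]; first by rewrite bB.
    by case: (y =P a) => [->|_] //=; rewrite aB.
  rewrite setDDl [[set a] :|: _]setUC -setDDl setU1K ?bC //.
  by apply/setDidPl; rewrite disjoint_sym disjoints1 aC.
have /negbTE -> : B != a |: C by apply: contraFneq aB => ->; rewrite setU11.
have /negbTE -> : B != b |: C by apply: contraFneq bB => ->; rewrite setU11.
by rewrite subrr.
Qed.

Lemma sum_set_basis (f : V) : f = \sum_B set_basis B *~ f B.
Proof.
apply/ffunP=> A; rewrite sum_ffunE (bigD1 A) //= ffunMzE ffunE eqxx big1.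
  by rewrite addr0 -mulrzl intz mulr1.
by move=> B nB; rewrite ffunMzE ffunE eq_sym (negbTE nB) mul0rz.
Qed.

Definition in_image d (u : V) := exists2 x, homog d.+1 x & down x = u.

Lemma in_imageD d u v : in_image d u -> in_image d v -> in_image d (u + v).
Proof. by case=> x hx <- [y hy <-]; exists (x + y); [exact: homogD|rewrite raddfD]. Qed.

Lemma in_imageMz d u z : in_image d u -> in_image d (u *~ z).
Proof. by case=> x hx <-; exists (x *~ z); [exact: homogMz|rewrite raddfMz]. Qed.

Lemma in_image0 d : in_image d 0.
Proof. by exists 0; [exact: homog0|rewrite raddf0]. Qed.

Lemma image_factorial d u : homog d u -> (2 * d + 1 <= n)%N -> in_image d (u *+ d.+1`!).
Proof.
move=> hu le_n; rewrite [u]sum_set_basis -sumrMnl.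
apply: (big_ind (in_image d)) => [||A _]; [exact: in_image0 | exact: in_imageD |].
case: (altP (#|A| =P d)) => [cA|/hu->]; last by rewrite mulr0z mul0rn; exact: in_image0.
have [||x [hx _] dx] := @image_basis A setT; rewrite ?subsetT ?cardsT ?card_ord ?cA //.
exists (x *~ u A); first by rewrite -cA; exact: homogMz.
by rewrite raddfMz /= dx cA !pmulrn mulrzAC.
Qed.

(** Functions of total zero are spanned by differences of basis vectors, and these
    are sums of exchanges. *)
Lemma image_total0 d u : homog d u -> (2 * d + 1 <= n)%N -> total u = 0 ->
  in_image d (u *+ d`!).
Proof.
move=> hu le_n u0.
have [A0 cA0] : exists A0 : {set 'I_n}, #|A0| = d by apply: set_of_card; lia.
have base (A : {set 'I_n}) : #|A| = #|A0| -> in_image d ((set_basis A - set_basis A0) *+ d`!).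
  move: A; apply: swap_ind => [|A a b]; first by rewrite subrr mul0rn; exact: in_image0.
  rewrite cA0 => cA aA bA IH; have [|x hx dx] := image_swap aA bA; first by rewrite cA.
  have -> : set_basis (b |: A :\ a) - set_basis A0 =
     (set_basis A - set_basis A0) - (set_basis A - set_basis (b |: A :\ a)).
    by rewrite opprB [RHS]addrC addrA subrK.
  rewrite mulrnBl; apply: in_imageD => //; rewrite -mulrN1z -cA -dx.
  by exists (x *~ -1); rewrite ?raddfMz //; exact: homogMz.
have -> : u = \sum_B (set_basis B - set_basis A0) *~ u B.
  under eq_bigr do rewrite mulrzBl.
  by rewrite sumrB -sum_set_basis -mulrz_sumr -/(total u) u0 mulr0z subr0.
rewrite -sumrMnl.
apply: (big_ind (in_image d)) => [||A _]; [exact: in_image0 | exact: in_imageD |].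
case: (altP (#|A| =P d)) => [cA|/hu->]; last by rewrite mulr0z mul0rn; exact: in_image0.
by rewrite pmulrn mulrzAC -pmulrn; apply: in_imageMz; apply: base; rewrite cA cA0.
Qed.

(** The multiple of a basis vector that makes the total zero is a multiple of
    [d + 1], which absorbs the extra factor of [image_factorial]. *)
Lemma image_total_dvd d u : homog d u -> (2 * d + 1 <= n)%N -> (d.+1 %| total u)%Z ->
  in_image d (u *+ d`!).
Proof.
move=> hu le_n /dvdzP[q uE].
have [A0 cA0] : exists A0 : {set 'I_n}, #|A0| = d by apply: set_of_card; lia.
have hA0 : homog d (set_basis A0) by rewrite -cA0; exact: homog_basis.
rewrite -[u](subrK (set_basis A0 *~ (q * d.+1))) mulrnDl; apply: in_imageD.
  apply: image_total0 => //; first by apply: homogB => //; apply: homogMz.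
  by rewrite raddfB raddfMz /= total_basis -mulrzl mulr1 intz uE subrr.
have -> : set_basis A0 *~ (q * d.+1) *+ d`! = set_basis A0 *+ d.+1`! *~ q.
  by rewrite factS mulrnA !pmulrn -!mulrzA; congr (_ *~ _); ring.
by apply: in_imageMz; apply: image_factorial.
Qed.

End SetFunctions.

(** * Finite abelian groups and their p-torsion *)

Section FiniteOrder.
Import GRing.Theory.
Local Open Scope ring_scope.

Lemma finite_order_inj (A : zmodType) (F : finType) (c : A -> F) :
  injective c -> exists m, finite_order A m.
Proof.
move=> c_inj; pose C := [set y | `[< exists x, c x = y >]].
have cC x : c x \in C by rewrite inE; apply/asboolP; exists x.
have pre (i : 'I_#|C|) : {x | c x = enum_val i}.
  by apply: cid; apply/asboolP; have := enum_valP i; rewrite inE.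
exists #|C|, (fun i => sval (pre i)); exists (fun x => enum_rank_in (cC x) (c x)).
  by move=> i; apply: enum_val_inj; rewrite enum_rankK_in // (svalP (pre i)).
by move=> x; apply: c_inj; rewrite (svalP (pre _)) enum_rankK_in.
Qed.

(** Translations embed [A] as a group of [m] permutations, to which Cauchy's and
    Lagrange's theorems apply. *)
Lemma finite_order_dvd (A : zmodType) m p : prime p -> finite_order A m ->
  (p %| m)%N <-> exists2 x : A, x != 0 & x *+ p = 0.
Proof.
move=> p_pr [f [h fK hK]].
have tr_inj x : injective (fun i => h (x + f i)).
  by move=> i j /(can_inj hK)/addrI/(can_inj fK).
pose tr x := perm (tr_inj x).
have trE x i : f (tr x i) = x + f i by rewrite permE hK.
have trD x y : tr (x + y) = (tr x * tr y)%g.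
  by apply/permP=> i; apply: (can_inj fK); rewrite permM !trE addrA [y + x]addrC.
have tr0 : tr 0 = 1%g by apply/permP=> i; apply: (can_inj fK); rewrite trE add0r perm1.
have tr_injective : injective tr.
  by move=> x y /(congr1 (fun s : 'S_m => f (s (h 0)))); rewrite !trE hK !addr0.
have trMn x k : tr (x *+ k) = (tr x ^+ k)%g.
  by elim: k => [|k IH]; rewrite ?tr0 // mulrS expgS trD IH.
pose T := [set tr (f i) | i : 'I_m].
have trT x : tr x \in T by rewrite -[x]hK; apply: imset_f.
have T_group : group_set T.
  apply/group_setP; split; first by rewrite -tr0 trT.
  by move=> _ _ /imsetP[i _ ->] /imsetP[j _ ->]; rewrite -trD trT.
have cT : #|Group T_group| = m.
  by rewrite card_imset ?card_ord //; exact: inj_comp tr_injective (can_inj fK).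
split=> [|[x nx px]].
  rewrite -cT => /(Cauchy p_pr)[s /imsetP[i _ sE] os].
  exists (f i).
    apply: contraTneq (prime_gt1 p_pr) => fi0.
    by rewrite -os sE fi0 tr0 order1.
  by apply: tr_injective; rewrite trMn -sE -os expg_order tr0.
rewrite -cT; suff <- : #[tr x]%g = p by apply: (@order_dvdG _ (Group T_group)); exact: trT.
apply: (@nt_prime_order _ p) => //; first by rewrite -trMn px tr0.
by rewrite -tr0 (inj_eq tr_injective).
Qed.

Lemma coprime_torsion (A : zmodType) (x : A) a b :
  coprime a b -> x *+ a = 0 -> x *+ b = 0 -> x = 0.
Proof.
case: a => [|a] cab xa xb; first by move: cab xb; rewrite /coprime gcd0n => /eqP->.
have [c _ /dvdnP[q e]] := Bezoutl b (ltn0Sn a).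
have := congr1 (GRing.natmul x) e.
by rewrite (eqP cab) mulrnDr mulr1n (mulnC c) (mulnC q) !mulrnA xa xb !mul0rn addr0.
Qed.

Definition torsion p (A : zmodType) : {pred A} := fun x => x *+ p == 0.

Fact torsion_closed p A : zmod_closed (@torsion p A).
Proof.
split=> [|x y]; rewrite !unfold_in /= ?mul0rn // mulrnBl => /eqP-> /eqP->.
by rewrite subrr.
Qed.
HB.instance Definition _ p A :=
  GRing.isZmodClosed.Build A (@torsion p A) (@torsion_closed p A).

(** When [x0] generates the [p]-torsion, that torsion is the only maximal
    elementary abelian [p]-subgroup. *)
Lemma p_rank1 (A : zmodType) p (x0 : A) : prime p -> x0 != 0 -> x0 *+ p = 0 ->
  (forall x, x *+ p = 0 -> exists z, x = x0 *~ z) -> p_rank_is p A 1.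
Proof.
move=> p_pr nx0 px0 gen; exists [the zmodClosed A of @torsion p A].
  split=> [x|F F_el _ x /F_el px]; first by rewrite unfold_in => /eqP.
  by rewrite unfold_in; apply/eqP.
(* Multiples of [x0] depend only on the multiplier modulo [p]. *)
have zeroP (z : int) : z%:~R = 0 :> 'F_p <-> x0 *~ z = 0.
  have dvdF (m : nat) : (m%:R == 0 :> 'F_p) = (x0 *+ m == 0).
    rewrite -(dvdn_pcharf (pchar_Fp p_pr)); apply/idP/eqP => [/dvdnP[q ->]|xm].
      by rewrite mulnC mulrnA px0 mul0rn.
    apply: contraNT nx0 => ndv; apply/eqP; apply: (@coprime_torsion _ _ p m) => //.
    by rewrite prime_coprime.
  have {}dvdF m : m%:R = 0 :> 'F_p <-> x0 *+ m = 0.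
    by split=> /eqP => [|xm]; [rewrite dvdF => /eqP | apply/eqP; rewrite dvdF].
  case: z => m; rewrite ?NegzE ?mulrNz -!pmulrn //.
  by split=> /eqP; rewrite oppr_eq0 => /eqP/dvdF->; rewrite oppr0.
pose f (v : 'rV['F_p]_1) := x0 *~ (v 0 0 : nat).
have fB : {morph f : u v / u - v}.
  move=> u v; apply/eqP; rewrite -subr_eq0 -mulrzBr -mulrzBr; apply/eqP/zeroP.
  by rewrite !rmorphB /= -!pmulrn !natr_Zp !mxE subrr.
pose F : {additive 'rV['F_p]_1 -> A} :=
  HB.pack f (GRing.isZmodMorphism.Build _ _ f fB).
have FE v : F v = x0 *~ (v 0 0 : nat) by [].
exists F.
  apply: raddf_inj => v; rewrite FE => /zeroP; rewrite -pmulrn natr_Zp => v0.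
  by apply/matrixP=> i j; rewrite !ord1 v0 mxE.
move=> x; rewrite unfold_in; split=> [/eqP/gen[z ->]|[v <-]].
  exists (const_mx z%:~R); rewrite FE mxE; apply/eqP; rewrite -subr_eq0 -mulrzBr.
  by apply/eqP/zeroP; rewrite rmorphB /= -pmulrn natr_Zp subrr.
by rewrite FE -!pmulrn mulrnAC px0 mul0rn.
Qed.

End FiniteOrder.

(** * Cochains and maps of coefficients *)

Section H2Facts.
Import GRing.Theory.
Local Open Scope ring_scope.
Local Open Scope quotient_scope.
Variables (G : finGroupType) (M : gModule G).

Definition H2class (z : Z2 M) : H2 M := \pi_(H2 M) z.

Fact H2class_is_zmod_morphism : {morph H2class : x y / x - y}.
Proof. by move=> x y; rewrite /H2class raddfB. Qed.
HB.instance Definition _ :=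
  GRing.isZmodMorphism.Build _ _ H2class H2class_is_zmod_morphism.

Lemma H2class_eq0 z : H2class z = 0 <-> exists f, val z = cobound1 f.
Proof.
have zE : (z \in @coboundary2 G M) = (H2class z == 0).
  by rewrite -[z in LHS]subr0 Quotient.idealrBE -(raddf0 H2class).
split=> [/eqP|z_cob]; first by rewrite -zE => /asboolP.
by apply/eqP; rewrite -zE; apply/asboolP.
Qed.

Lemma H2class_surj (x : H2 M) : exists z, H2class z = x.
Proof. by elim/quotW: x => z; exists z. Qed.

End H2Facts.

Section CochainMaps.
Import GRing.Theory.
Local Open Scope ring_scope.
Variable G : finGroupType.

(** Summing the cocycle identity over its last argument: the order of the group
    annihilates cohomology. *)
Lemma cocycle_sum (M : gModule G) (z : {ffun G * G -> M}) : cobound2 z = 0 ->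
  cobound1 [ffun g => \sum_k z (g, k)] = z *+ #|G|.
Proof.
move=> z0; apply/ffunP=> -[g h]; rewrite ffunMnE !ffunE /=.
have gact_sum (F : G -> M) : gact g (\sum_k F k) = \sum_k gact g (F k).
  apply: (big_morph (gact g)) => [x y|]; first exact: gactD.
  by have := gactB g 0 (0 : M); rewrite !subrr.
rewrite gact_sum; apply/eqP; rewrite -subr_eq0; apply/eqP.
rewrite -[#|G|]/#|[pred k : G | true]| -sumr_const.
rewrite [X in _ + X - _](reindex_inj (mulgI h)) /= -!sumrB -big_split -sumrB /=.
rewrite big1 // => k _; have := congr1 (fun f : {ffun _ -> M} => f (g, h, k)) z0.
by rewrite !ffunE.
Qed.

Definition cobound0 (M : gModule G) (u : M) : {ffun G -> M} :=
  [ffun g => gact g u - u].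

Fact cobound0_is_zmod_morphism M : {morph @cobound0 M : x y / x - y}.
Proof.
by move=> x y; apply/ffunP=> g; rewrite !ffunE gactB !opprD !opprK addrACA.
Qed.
HB.instance Definition _ M :=
  GRing.isZmodMorphism.Build _ _ (@cobound0 M) (@cobound0_is_zmod_morphism M).
HB.instance Definition _ M :=
  GRing.isZmodMorphism.Build _ _ (@cobound1 G M) (@cobound1B G M).
HB.instance Definition _ M :=
  GRing.isZmodMorphism.Build _ _ (@cobound2 G M) (@cobound2B G M).

Lemma cobound10 (M : gModule G) (u : M) : cobound1 (cobound0 u) = 0.
Proof.
apply/ffunP=> -[g h]; rewrite !ffunE /= gactB gactM opprB !addrA.
by rewrite [LHS](ACl ((1*4)*(3*6)*(5*2)))%AC /= !subrr !addr0.
Qed.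

Definition push (T : finType) (M M' : zmodType) (phi : M -> M') (f : {ffun T -> M}) :
  {ffun T -> M'} := [ffun t => phi (f t)].

Fact push_is_zmod_morphism (T : finType) (M M' : zmodType) (phi : {additive M -> M'}) :
  {morph (push phi : {ffun T -> M} -> {ffun T -> M'}) : x y / x - y}.
Proof. by move=> x y; apply/ffunP=> t; rewrite !ffunE raddfB. Qed.
HB.instance Definition _ (T : finType) (M M' : zmodType) (phi : {additive M -> M'}) :=
  GRing.isZmodMorphism.Build _ _ (@push T M M' phi) (@push_is_zmod_morphism T M M' phi).

End CochainMaps.

Section Push.
Import GRing.Theory.
Local Open Scope ring_scope.
Variables (G : finGroupType) (M M' : gModule G) (phi : {additive M -> M'}).

Hypothesis phi_act : forall g x, phi (gact g x) = gact g (phi x).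

Lemma push_cobound0 u : push phi (cobound0 u) = cobound0 (phi u).
Proof. by apply/ffunP=> g; rewrite !ffunE raddfB /= phi_act. Qed.

Lemma push_cobound1 f : push phi (cobound1 f) = cobound1 (push phi f).
Proof. by apply/ffunP=> -[g h]; rewrite !ffunE raddfD raddfB /= phi_act. Qed.

Lemma push_cobound2 f : push phi (cobound2 f) = cobound2 (push phi f).
Proof.
by apply/ffunP=> -[[g h] k]; rewrite !ffunE raddfB raddfD raddfB /= phi_act.
Qed.

End Push.

(** * Cohomology of permutation modules on sets *)

Section CrossedHom.
Import GRing.Theory Num.Theory.
Local Open Scope ring_scope.
Variable n : nat.

Lemma set_act1 (R : zmodType) (f : {ffun {set 'I_n} -> R}) : set_act 1%g f = f.
Proof.
by apply/ffunP=> B; rewrite ffunE imset_perm1.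
Qed.

Definition set_module (R : zmodType) : gModule 'S_n :=
  GModule (@set_act1 R) (@set_actM n R) (fun g => raddfD (@set_act n R g)).

Section Coefficients.
Variables (R : zmodType) (f : {ffun 'S_n -> set_module R}).
Hypothesis f_crossed : cobound1 f = 0.

Lemma crossed_homE g h (B : {set 'I_n}) : f (g * h)%g B = f g B + f h (g @: B).
Proof.
have := congr1 (fun u : {ffun _ -> set_module R} => u (g, h) B) f_crossed.
rewrite !ffunE /= => /eqP; rewrite addrAC subr_eq0 => /eqP <-.
by rewrite addrC.
Qed.

(** On the stabilizer of [B], [f] evaluated at [B] is a homomorphism, and the
    stabilizer is generated by transpositions exchanging letters on the same side
    of [B]; twice a homomorphism vanishes on involutions. *)
Lemma crossed_stab (h : 'S_n) (B : {set 'I_n}) : h @: B = B -> f h B *+ 2 = 0.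
Proof.
have f1 : f 1%g B = 0.
  have := crossed_homE 1 1 B; rewrite mulg1 imset_perm1.
  by move/eqP; rewrite -subr_eq0 opprD addNKr oppr_eq0 => /eqP.
have [m] := ubnP #|[pred x | h x != x]|; elim: m h => // m IH h; rewrite ltnS => le_m hB.
have hBE x : (h x \in B) = (x \in B).
  by rewrite -{1}hB mem_imset //; exact: perm_inj.
case: (pickP [pred x | h x != x]) => [x /= hx|hid]; last first.
  rewrite (_ : h = 1%g) ?f1 ?mul0rn //; apply/permP=> x; rewrite perm1.
  exact/eqP/negbFE/hid.
pose t := tperm x (h x).
have tB : t @: B = B.
  apply/setP=> y; rewrite -[y](tpermK x (h x)) mem_imset; last exact: perm_inj.
  rewrite tpermK /t; case: tpermP => [->|->|//]; rewrite ?hBE //.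
have ft : f t B *+ 2 = 0.
  by have := crossed_homE t t B; rewrite tperm2 f1 tB -mulr2n.
(* [t * h] moves fewer letters than [h], as it fixes [h x]. *)
have -> : h = (t * (t * h))%g by rewrite mulgA tperm2 mul1g.
rewrite crossed_homE tB mulrnDl ft add0r; apply: IH.
  apply: leq_trans le_m; apply: proper_card; apply/properP; split.
    apply/subsetP=> y; rewrite !inE permM /t; case: tpermP => [-> _ //|->|//].
    by rewrite eqxx.
  exists (h x); rewrite !inE ?(inj_eq perm_inj) //.
  by rewrite permM tpermR eqxx.
by rewrite imset_permM tB hB.
Qed.

(** Shapiro's lemma in degree one: choosing for each set [B] a permutation [r B]
    to a representative of its orbit, the value of [2 f] at [r B] and [B] does not
    depend on the choice, by [crossed_stab], and gives the required potential. *)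
Lemma crossed_hom : exists u, f *+ 2 = cobound0 u.
Proof.
pose orb (B C : {set 'I_n}) := [exists g : 'S_n, g @: B == C].
pose C B := odflt B [pick C | orb B C].
have CP (B : {set 'I_n}) : exists g : 'S_n, g @: B == C B.
  rewrite /C; case: pickP => [D /existsP //|none].
  by exists 1%g; rewrite imset_perm1.
have Cact (g : 'S_n) (B : {set 'I_n}) : C (g @: B) = C B.
  have e : orb (g @: B) =1 orb B.
    move=> D; apply/existsP/existsP => [[h /eqP <-]|[h /eqP <-]].
      by exists (g * h)%g; rewrite imset_permM.
    by exists (g^-1 * h)%g; rewrite -imset_permM mulKVg.
  rewrite /C (eq_pick e); case: pickP => // /(_ B)/negbT/negP[].
  by apply/existsP; exists 1%g; rewrite imset_perm1.
pose r (B : {set 'I_n}) := xchoose (CP B).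
have rP (B : {set 'I_n}) : r B @: B = C B by apply/eqP; exact: (xchooseP (CP B)).
have indep (B : {set 'I_n}) (g h : 'S_n) : g @: B = h @: B -> f g B *+ 2 = f h B *+ 2.
  move=> gh; have -> : g = ((g * h^-1) * h)%g by rewrite mulgKV.
  have fixB : (g * h^-1)%g @: B = B by rewrite imset_permM gh -imset_permM mulgV imset_perm1.
  by rewrite crossed_homE fixB mulrnDl (crossed_stab fixB) add0r.
exists [ffun B : {set 'I_n} => - (f (r B) B *+ 2)].
apply/ffunP=> g; apply/ffunP=> B; rewrite !ffunMnE !ffunE opprK.
rewrite [X in _ + X](@indep _ _ (g * r (g @: B))%g); last by rewrite imset_permM !rP Cact.
by rewrite crossed_homE mulrnDl addrCA addNr addr0.
Qed.

End Coefficients.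

Lemma reduce_act N g (f : {ffun {set 'I_n} -> int}) :
  reduce N (set_act g f) = set_act g (reduce N f).
Proof. by apply/ffunP=> B; rewrite !ffunE. Qed.

Lemma reduce_surj N (u : {ffun {set 'I_n} -> 'Z_N}) : exists v, reduce N v = u.
Proof.
exists [ffun B : {set 'I_n} => Posz (u B)]; apply/ffunP=> B; rewrite !ffunE.
by rewrite -pmulrn natr_Zp.
Qed.

Lemma reduce_eq0 N (f : {ffun {set 'I_n} -> int}) : 
  (1 < N)%N -> reduce N f = 0 -> exists v, f = v *+ N.
Proof.
move=> N_gt1 f0; exists [ffun B : {set 'I_n} => (f B %/ N)%Z].
apply/ffunP=> B; rewrite ffunMnE ffunE.
have := congr1 (fun u : {ffun {set 'I_n} -> 'Z_N} => u B) f0; rewrite !ffunE.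
have dvdZ (m : nat) : (m%:R == 0 :> 'Z_N) = (N %| m)%N.
  by rewrite -(inj_eq val_inj) /= val_Zp_nat //.
move=> /eqP e; have : (N %| f B)%Z.
  case: (f B) e => m /=; rewrite ?NegzE ?mulrNz ?oppr_eq0 -?pmulrn dvdZ //.
by move/divzK => {1}<-; rewrite -mulr_natr natz.
Qed.

Lemma card_perm_gt1 : (1 < n)%N -> (1 < #|'S_n|)%N.
Proof.
move=> n_gt1; pose i0 := Ordinal (ltnW n_gt1); pose i1 := Ordinal n_gt1.
rewrite (cardD1 1%g) (cardD1 (tperm i0 i1)) !inE andbT.
suff -> : tperm i0 i1 != 1%g by [].
by apply/eqP => /permP/(_ i0); rewrite tpermL perm1.
Qed.

(** With [N] the order of the group, [z *+ N] is the coboundary of [s].  Modulo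
    [N], [s] is a crossed homomorphism, so [s *+ 2] is principal up to a multiple
    of [N]; dividing by [N] exhibits [z *+ 2] as a coboundary.  This is the
    connecting map from degree one modulo [N] to degree two. *)
Lemma crossed_cocycle (z : {ffun 'S_n * 'S_n -> set_module int}) : (1 < n)%N ->
  cobound2 z = 0 -> exists f, z *+ 2 = cobound1 f.
Proof.
move=> n_gt1 z0; set N := #|'S_n|.
have N_gt1 : (1 < N)%N by exact: card_perm_gt1.
pose s : {ffun 'S_n -> set_module int} := [ffun g => \sum_k z (g, k)].
have ds : cobound1 s = z *+ N by exact: cocycle_sum.
have redN (v : {ffun {set 'I_n} -> int}) : reduce N (v *+ N) = 0.
  apply/ffunP=> B; rewrite !ffunE ffunMnE -mulr_natr rmorphM /= natz -pmulrn.
  by rewrite pchar_Zp ?mulr0.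
have rs0 : cobound1 (push (@reduce n N) s : {ffun 'S_n -> set_module 'Z_N}) = 0.
  rewrite -(@push_cobound1 _ (set_module int) (set_module 'Z_N) (@reduce n N) (@reduce_act N)) ds.
  by apply/ffunP=> t; rewrite !ffunE ffunMnE /= redN.
have [u' hu'] := crossed_hom rs0; have [u hu] := reduce_surj u'.
have [f hf] : exists f : {ffun 'S_n -> set_module int},
    s *+ 2 - cobound0 (u : set_module int) = f *+ N.
  have /choice[f hf] g : exists v : set_module int,
      (s *+ 2 - cobound0 (u : set_module int)) g = v *+ N.
    apply: reduce_eq0 => //; rewrite !(ffunMnE, ffunE) raddfB raddfMn raddfB /=.
    rewrite reduce_act hu; have := congr1 (fun f : {ffun _ -> set_module 'Z_N} => f g) hu'.
    by rewrite !(ffunMnE, ffunE) => ->; rewrite subrr.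
  by exists [ffun g => f g]; apply/ffunP=> g; rewrite hf ffunMnE ffunE.
exists f; have := congr1 (@cobound1 _ _) hf.
rewrite raddfB !raddfMn /= cobound10 subr0 ds => e.
apply/ffunP=> t; apply/ffunP=> B.
have := congr1 (fun f : {ffun _ -> set_module int} => f t B) e.
rewrite !ffunMnE mulrnAC ; apply: pmulrnI; exact: ltnW.
Qed.

End CrossedHom.

(** * The kernel of the down map *)

Section ColumnProducts.
Import GRing.Theory Num.Theory.
Local Open Scope ring_scope.
Variable n : nat.
Local Notation V := {ffun {set 'I_n} -> int}.
Implicit Types (s : seq ('I_n * 'I_n)) (B W : {set 'I_n}).

Definition letters s := unzip1 s ++ unzip2 s.

(** The product of the differences [b] - [a] over the pairs [(a, b)] of [s],
    expanded in squarefree monomials: only the sets of [size s] letters that meet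
    each pair exactly once have a nonzero coefficient, which is a sign. *)
Definition colprod s : V := [ffun B : {set 'I_n} =>
  (#|B| == size s)%:R * \prod_(ab <- s) ((ab.2 \in B)%:R - (ab.1 \in B)%:R)].

Lemma homog_colprod s : homog (size s) (colprod s).
Proof. by move=> B /negbTE nB; rewrite ffunE nB mul0r. Qed.

Lemma uniq_letters_cons a b s : uniq (letters ((a, b) :: s)) =
  [&& a != b, a \notin letters s, b \notin letters s & uniq (letters s)].
Proof.
rewrite /letters /= -[b :: _]cat1s uniq_catCA /= !mem_cat inE !negb_or.
by rewrite -!andbA; case: (a == b) => //=; do !bool_congr.
Qed.

Lemma letters_mem s ab : ab \in s -> (ab.1 \in letters s) * (ab.2 \in letters s).
Proof. by move=> abs; rewrite !mem_cat (map_f _ abs) (map_f snd abs) orbT. Qed.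

Lemma colprod_cons a b s : uniq (letters ((a, b) :: s)) ->
  colprod ((a, b) :: s) = mul_diff b a (colprod s).
Proof.
rewrite uniq_letters_cons => /and4P[nab nas nbs _].
apply/ffunP=> B; rewrite !ffunE big_cons /= mulrCA.
have -> : \prod_(ab <- s) ((ab.2 \in B :\ b :\ a)%:R - (ab.1 \in B :\ b :\ a)%:R) =
    \prod_(ab <- s) ((ab.2 \in B)%:R - (ab.1 \in B)%:R) :> int.
  apply: eq_big_seq => ab /letters_mem[s1 s2]; rewrite !inE.
  have neq x y : x \in letters s -> y \notin letters s -> x != y.
    by move=> xs; apply: contraNneq => <-.
  by rewrite !(neq _ a) // !(neq _ b).
case aB: (a \in B); case bB: (b \in B); rewrite ?subrr ?mul0r //; congr (_ * (_ * _)).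
  rewrite (cardsD1 b B) (cardsD1 a (B :\ b)) !inE aB bB nab /= add0n eqSS //.
by rewrite (cardsD1 b B) (cardsD1 a (B :\ b)) !inE aB bB andbF.
Qed.

Lemma colprod_supp s B : uniq (letters s) -> colprod s B != 0 -> {subset B <= letters s}.
Proof.
elim: s B => [|[a b] s IH] B.
  move=> _; rewrite ffunE big_nil mulr1 pnatr_eq0 eqb0 negbK cards_eq0 => /eqP-> x.
  by rewrite inE.
move=> us; rewrite colprod_cons // ffunE mulf_eq0 negb_or => /andP[_].
move: us; rewrite uniq_letters_cons => /and4P[_ _ _ us] /IH-/(_ us) sB x xB.
rewrite /letters /= inE mem_cat inE.
have := sB x; rewrite !inE xB andbT mem_cat.
case: (x == a) => //=; case: (x == b) => /=; first by rewrite !orbT.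
by move/(_ isT).
Qed.

Lemma down_colprod s : uniq (letters s) -> down (colprod s) = 0.
Proof.
elim: s => [|[a b] s IH].
  move=> _; apply/ffunP=> A; rewrite !ffunE big1 // => b bA.
  by rewrite ffunE cardsU1 bA mul0r.
move=> us; rewrite colprod_cons //; move: us; rewrite uniq_letters_cons.
move=> /and4P[nab nas nbs us]; rewrite down_mul_diff 1?eq_sym // ?IH //.
  by apply/ffunP=> B; rewrite !ffunE mulr0.
move=> B abB; apply/eqP; apply: contraTT abB => /(colprod_supp us) sB.
by rewrite negb_or (contra (sB b)) // (contra (sB a)).
Qed.

Lemma colprod_perm s1 s2 : perm_eq s1 s2 -> colprod s1 = colprod s2.
Proof.
by move=> e; apply/ffunP=> B; rewrite !ffunE (perm_size e) (perm_big _ e).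
Qed.

Lemma colprod_swap s a b B : uniq (letters s) -> (a, b) \in s ->
  colprod s (tperm a b @: B) = - colprod s B.
Proof.
move=> us abs; have e := perm_to_rem abs.
have ul : uniq (letters ((a, b) :: rem (a, b) s)).
  rewrite -(perm_uniq (_ : perm_eq (letters s) _)) //.
  by apply: perm_cat; apply: perm_map.
have tE x : (x \in tperm a b @: B) = (tperm a b x \in B).
  by rewrite -{1}[x](tpermK a b) mem_imset //; exact: perm_inj.
rewrite (colprod_perm e) !ffunE !big_cons /= card_imset; last exact: perm_inj.
rewrite !tE tpermL tpermR -mulrN -mulNr opprB; congr (_ * (_ * _)).
move: ul; rewrite uniq_letters_cons => /and4P[_ nas nbs _].
apply: eq_big_seq => ab /letters_mem[s1 s2]; rewrite !tE.
have neq x y : x \in letters (rem (a, b) s) -> y \notin letters (rem (a, b) s) -> y != x.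
  by move=> xs; apply: contraNneq => ->.
by rewrite !tpermD // neq.
Qed.

(** Integer combinations of products of [k] differences of letters of [W]; an
    inductive predicate because [col_span_lift] treats the terms one at a time. *)
Inductive col_span W k : V -> Prop :=
| col_span0 : col_span W k 0
| col_spanD f c s of col_span W k f & size s = k & uniq (letters s) &
    {subset letters s <= W} : col_span W k (f + colprod s *~ c).

Lemma col_span_add W k f g : col_span W k f -> col_span W k g -> col_span W k (f + g).
Proof.
move=> hf; elim=> [|h c s _ IH ss us sW]; first by rewrite addr0.
by rewrite addrA; apply: col_spanD.
Qed.

Lemma col_span_sub W W' k f : W \subset W' -> col_span W k f -> col_span W' k f.
Proof.
move=> /subsetP sWW; elim=> [|h c s _ IH ss us sW]; first exact: col_span0.
by apply: col_spanD => // x /sW/sWW.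
Qed.

Lemma col_spanP W k f : col_span W k f ->
  [/\ homog k f, forall B, f B != 0 -> B \subset W & down f = 0].
Proof.
elim=> [|h c s _ [IH1 IH2 IH3] ss us sW].
  by split; [exact: homog0 | move=> B; rewrite ffunE eqxx | rewrite raddf0].
split.
- by apply: homogD => //; apply: homogMz; rewrite -ss; exact: homog_colprod.
- move=> B; rewrite ffunE ffunMzE => nz.
  case: (altP (h B =P 0)) nz => [->|/IH2 //]; rewrite add0r.
  case: (altP (colprod s B =P 0)) => [->|/(colprod_supp us) sB _]; first by rewrite mul0rz eqxx.
  by apply/subsetP=> x /sB/sW.
by rewrite raddfD raddfMz /= down_colprod // IH3 mul0rz addr0.
Qed.

(** A product of [k] differences in [W :\ w] leaves a free letter [d] of that set;
    multiplying it by [w] - [d] gives a product whose coefficients at the sets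
    containing [w] are the given ones. *)
Lemma col_span_lift W k w g : w \in W -> (2 * k.+1 <= #|W|)%N ->
  col_span (W :\ w) k g ->
  exists2 f, col_span W k.+1 f & forall B, w \notin B -> f (w |: B) = g B.
Proof.
move=> wW le_W; elim=> [|h c s _ [f hf fE] ss us sW].
  by exists 0; [exact: col_span0 | move=> B _; rewrite !ffunE].
have [d dW ds] : exists2 d, d \in W :\ w & d \notin letters s.
  have : ~~ (W :\ w \subset [set x in letters s]).
    have cl : #|[set x in letters s]| = (k + k)%N.
      have -> : #|[set x in letters s]| = size (letters s) by rewrite cardsE; apply/card_uniqP.
      by rewrite size_cat !size_map ss.
    apply/negP => /subset_leq_card; rewrite cl.
    by move: le_W; rewrite (cardsD1 w W) wW; lia.
  by case/subsetPn=> d dW; rewrite inE => ds; exists d.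
have ws : w \notin letters s by apply/negP => /sW; rewrite !inE eqxx.
have udw : uniq (letters ((d, w) :: s)).
  by rewrite uniq_letters_cons ds ws us !andbT; move: dW; rewrite !inE => /andP[].
exists (f + colprod ((d, w) :: s) *~ c).
  apply: col_spanD => //=; first by rewrite ss.
  move: dW; rewrite !inE => /andP[_ dW] x; rewrite /letters /= inE mem_cat inE.
  case/or4P=> [/eqP->|xs|/eqP->|xs] //.
    by have := sW x; rewrite mem_cat xs => /(_ isT)/setD1P[].
  by have := sW x; rewrite mem_cat xs orbT => /(_ isT)/setD1P[].
move=> B wB; rewrite !ffunE !ffunMzE fE // colprod_cons // ffunE setU11 setU1K //.
congr (_ + _ *~ _); move: dW; rewrite !inE => /andP[/negbTE-> _] /=.
case: (boolP (d \in B)) => dB; last first.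
  rewrite subr0 mul1r; congr (colprod s _); apply/setDidPl.
  by rewrite disjoint_sym disjoints1.
rewrite subrr mul0r; apply/esym/eqP; apply: contraNT ds => /(colprod_supp us).
exact.
Qed.

(** Write [f] as [w] times [g] plus a part without the letter [w].  Then [down g]
    vanishes, [g] lifts to a combination [f'] of products by [col_span_lift], and
    [f - f'] is in the kernel and does not involve [w].  The induction applies to
    it unless [W] has [2 * k] letters, and then it is zero by [down_injective]. *)
Lemma kernel_down_span W k f : homog k f -> (forall B, f B != 0 -> B \subset W) ->
  down f = 0 -> (2 * k <= #|W|)%N -> col_span W k f.
Proof.
have [m] := ubnP #|W|; elim: m W k f => // m IH W k f; rewrite ltnS => le_m hf sf df le_k.
case: k => [|k] in hf le_k *.
  have -> : f = 0 + colprod [::] *~ f set0.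
    apply/ffunP=> B; rewrite !ffunE ffunMzE ffunE big_nil mulr1 add0r cards_eq0.
    case: eqP => [->|/eqP nB]; first by rewrite -mulrzl mulr1 intz.
    by rewrite mul0rz hf // cards_eq0.
  by apply: col_spanD => //; exact: col_span0.
have [w wW] : exists w, w \in W by apply/card_gt0P; move: le_k; lia.
have cW : #|W| = #|W :\ w|.+1 by rewrite (cardsD1 w) wW.
have cm : (#|W :\ w| < m)%N by rewrite -cW.
have sWw B : w \notin B -> B \subset W -> B \subset W :\ w by move=> wB sB; rewrite subsetD1 sB.
pose g : V := [ffun B : {set 'I_n} => if w \in B then 0 else f (w |: B)].
have hg : col_span (W :\ w) k g.
  apply: IH => //; last by move: le_k; rewrite cW; lia.
  - by move=> B nB; rewrite ffunE; case: ifPn => // wB; rewrite hf // cardsU1 wB.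
  - move=> B; rewrite ffunE; case: ifPn => [|wB /sf]; first by rewrite eqxx.
    by rewrite subUset => /andP[_]; apply: sWw.
  apply/ffunP=> A; rewrite !ffunE.
  case: (boolP (w \in A)) => wA.
    by rewrite big1 // => b _; rewrite ffunE !inE wA orbT.
  rewrite (bigD1 w) //= ffunE setU11 add0r.
  have := congr1 (fun u : V => u (w |: A)) df; rewrite !ffunE => df_wA; rewrite -[RHS]df_wA.
  apply: eq_big => [b|b /andP[bA bw]]; first by rewrite !inE negb_or andbC.
  by rewrite ffunE !inE (negbTE wA) eq_sym (negbTE bw) setUCA.
have [f' f'span f'E] := col_span_lift wW le_k hg.
have [hf' sf' df'] := col_spanP f'span.
rewrite -[f](subrK f'); apply: col_span_add => //.
have hh : homog k.+1 (f - f') by exact: homogB.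
have dh : down (f - f') = 0 by rewrite raddfB /= df df' subrr.
have sh B : (f - f') B != 0 -> B \subset W :\ w.
  case: (boolP (w \in B)) => wB.
    by rewrite -(setD1K wB) !ffunE f'E ?ffunE !inE eqxx //= subrr eqxx.
  move=> nz; apply: sWw => //.
  case: (altP (f B =P 0)) => [fB|/sf //].
  apply: sf'; apply: contraNneq nz => f'B.
  by rewrite !ffunE fB f'B subrr.
case: (leqP (2 * k.+1) #|W :\ w|) => [le_k'|lt_k].
  by apply: (@col_span_sub (W :\ w)); [exact: subD1set | exact: IH].
by rewrite (down_injective hh sh lt_k dh); exact: col_span0.
Qed.

End ColumnProducts.

(** * Two-row Specht modules as kernels of the down map *)

Section TwoRowSpecht.
Import GRing.Theory Num.Theory.
Local Open Scope ring_scope.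
Variables n k : nat.
Hypotheses (n_gt1 : (1 < n)%N) (le_2k_n : (2 * k <= n)%N).
Local Notation la := [:: (n - k)%N; k].
Local Notation V := {ffun {set 'I_n} -> int}.
Implicit Types (T : tableau n la) (t : tabloid n la) (B : {set 'I_n}).

Definition row T i : nat := (val T i).1.
Definition col T i : nat := (val T i).2.

Lemma card_initial m : (m <= n)%N -> #|[set c : 'I_n | (c < m)%N]| = m.
Proof.
move=> le_mn; rewrite -sum1_card -[RHS]card_ord -sum1_card.
rewrite (big_ord_widen_cond n (fun _ => true) (fun=> 1%N)) //=.
by apply: eq_bigl => i; rewrite inE.
Qed.

Lemma cell_inj T i j : row T i = row T j -> col T i = col T j -> i = j.
Proof.
case/andP: (valP T) => /injectiveP injT _ er ec; apply: injT.
rewrite [val T i]surjective_pairing [val T j]surjective_pairing.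
by congr (_, _); apply: val_inj.
Qed.

Lemma cellP T i : row T i = 0%N /\ (col T i < n - k)%N \/ row T i = 1%N /\ (col T i < k)%N.
Proof.
case/andP: (valP T) => _ /forallP/(_ i); rewrite inE /row /col.
by case: (nat_of_ord _.1) => [|[|r]] /=; [left | right | rewrite nth_nil].
Qed.

Definition row_set T r := [set i | row T i == r].

Lemma card_row_le T r m : (m <= n)%N -> (forall i, row T i = r -> (col T i < m)%N) ->
  (#|row_set T r| <= m)%N.
Proof.
move=> le_mn bound; rewrite -(card_initial le_mn).
rewrite -(@card_in_imset _ _ (fun i => (val T i).2)).
  apply/subset_leq_card/subsetP=> _ /imsetP[i + ->]; rewrite !inE => /eqP.
  exact: bound.
move=> i j; rewrite !inE => /eqP ri /eqP rj /(congr1 val) e.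
by apply: (@cell_inj T) => //; rewrite ri.
Qed.

(** The rows have at most [k] and [n - k] letters, and together all [n]. *)
Lemma card_row T : #|row_set T 1| = k /\ #|row_set T 0| = (n - k)%N.
Proof.
have le1 : (#|row_set T 1| <= k)%N.
  apply: card_row_le; first by lia.
  by move=> i; case: (cellP T i) => -[-> //].
have le0 : (#|row_set T 0| <= n - k)%N.
  apply: card_row_le; first by lia.
  by move=> i; case: (cellP T i) => -[-> //].
have : (#|row_set T 0| + #|row_set T 1| = n)%N.
  have -> : row_set T 1 = ~: row_set T 0.
    by apply/setP=> i; rewrite !inE; case: (cellP T i) => -[-> _].
  by rewrite cardsC card_ord.
by move: le0 le1; move: #|row_set T 0| #|row_set T 1| => x y; split; lia.
Qed.

Lemma row0_surj T c : (c < n - k)%N -> exists2 i, row T i = 0%N & col T i = c.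
Proof.
move=> lt_c; have lt_cn : (c < n)%N by lia.
have : Ordinal lt_cn \in (fun i => (val T i).2) @: row_set T 0.
  suff -> : (fun i => (val T i).2) @: row_set T 0 = [set c : 'I_n | (c < n - k)%N].
    by rewrite inE.
  apply/eqP; rewrite eqEcard card_initial ?leq_subr // card_in_imset.
    rewrite (card_row T).2 leqnn andbT; apply/subsetP=> _ /imsetP[i + ->].
    by rewrite !inE /=; case: (cellP T i) => -[-> //].
  move=> i j; rewrite !inE => /eqP ri /eqP rj /(congr1 val) e.
  by apply: (@cell_inj T) => //; rewrite ri.
by case/imsetP=> i; rewrite inE => /eqP ri /(congr1 val) /= e; exists i.
Qed.

Lemma rowset_tabloid_of T : rowset (tabloid_of T) = row_set T 1.
Proof. by apply/setP=> i; rewrite !inE /= ffunE. Qed.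

Lemma tabloidP t : exists T, t = tabloid_of T.
Proof. by case/existsP: (valP t) => T /eqP e; exists T; apply: val_inj. Qed.

Lemma card_rowset t : #|rowset t| = k.
Proof. by have [T ->] := tabloidP t; rewrite rowset_tabloid_of (card_row T).1. Qed.

Lemma rowset_inj : injective (@rowset n la).
Proof.
move=> t u /setP e; apply/val_inj/ffunP=> i; apply/val_inj => /=.
have tabE (v : tabloid n la) : (val v i : nat) = (i \in rowset v) :> nat.
  have [T ->] := tabloidP v; rewrite inE /= ffunE -/(row T i).
  by case: (cellP T i) => -[-> _].
by rewrite !tabE e.
Qed.

Lemma rowset_act g t : rowset (tabloid_act g t) = g^-1%g @: rowset t.
Proof.
apply/setP=> i; rewrite -[i in RHS](permK g) mem_imset; last exact: perm_inj.
by rewrite !inE /= ffunE.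
Qed.

Lemma tableau_of_rows (l0 l1 : seq 'I_n) : uniq (l0 ++ l1) ->
  size l0 = (n - k)%N -> size l1 = k -> exists T,
  (forall i, i \in l0 -> row T i = 0%N /\ col T i = index i l0) /\
  (forall i, i \in l1 -> row T i = 1%N /\ col T i = index i l1).
Proof.
move=> ul s0 s1; pose o j : 'I_n := insubd (Ordinal n_gt1) j.
have oE j : (j < n)%N -> (o j : nat) = j by rewrite val_insubd => ->.
have mem i : (i \in l0) || (i \in l1).
  have c : #|[set x in l0 ++ l1]| = size (l0 ++ l1) by rewrite cardsE; apply/card_uniqP.
  have : [set x in l0 ++ l1] == setT.
    by rewrite eqEcard subsetT cardsT card_ord c size_cat s0 s1; lia.
  by move/eqP/setP/(_ i); rewrite !inE mem_cat.
pose F : {ffun 'I_n -> 'I_n * 'I_n} := [ffun i =>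
  if i \in l1 then (o 1%N, o (index i l1)) else (o 0%N, o (index i l0))].
have lt1 i : i \in l1 -> (index i l1 < k)%N by rewrite -index_mem s1.
have lt0 i : i \notin l1 -> (index i l0 < n - k)%N.
  by have := mem i; rewrite orbC => /orP[->|] //; rewrite -index_mem s0.
have lt1n i : i \in l1 -> (index i l1 < n)%N by move/lt1/leq_trans; apply; lia.
have lt0n i : i \notin l1 -> (index i l0 < n)%N by move/lt0/leq_trans; apply; lia.
have o1 : (o 1%N : nat) = 1%N by exact: oE.
have o0 : (o 0%N : nat) = 0%N by apply: oE; exact: ltnW.
have F_tab : is_tableau la F.
  apply/andP; split; last first.
    apply/forallP=> i; rewrite inE ffunE; case: ifPn => il /=.
      by rewrite o1 oE /= ?lt1 ?lt1n.
    by rewrite o0 oE /= ?lt0 ?lt0n.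
  apply/injectiveP=> i j; rewrite !ffunE.
  case: ifPn => il; case: ifPn => jl eF;
    have /= e1 := congr1 (fun c => val c.1) eF; have /= e2 := congr1 (fun c => val c.2) eF.
  - move: e2; rewrite !oE ?lt1n // => e.
    by rewrite -(nth_index i il) e nth_index.
  - by rewrite o1 o0 in e1.
  - by rewrite o1 o0 in e1.
  move: e2; rewrite !oE ?lt0n // => e.
  have il0 : i \in l0 by have := mem i; rewrite (negbTE il) orbF.
  have jl0 : j \in l0 by have := mem j; rewrite (negbTE jl) orbF.
  by rewrite -(nth_index i il0) e nth_index.
exists (Sub F F_tab); split=> i il; rewrite /row /col /= ffunE.
  have il1 : i \notin l1.
    by move: ul; rewrite cat_uniq => /and3P[_ /hasPn h _]; apply/negP => /h /=; rewrite il.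
  by rewrite (negbTE il1) /= o0 oE ?lt0n.
by rewrite il /= o1 oE ?lt1n.
Qed.

Lemma polytabloidE T t : polytabloid T t =
  \sum_(s in column_stabilizer T) (t == tabloid_of (tableau_act s T))%:R * (-1) ^+ s.
Proof.
rewrite sum_ffunE; apply: eq_bigr => s _.
by case: (odd_perm s); rewrite ?expr1 ?expr0 ?mulrN1z ?mulr1z !ffunE ?mulrN1 ?mulr1.
Qed.

(** Composing with a transposition of the column stabilizer permutes it and
    reverses the signs. *)
Lemma polytabloid_swap T t a b : a != b -> col T a = col T b ->
  polytabloid T (tabloid_act (tperm a b) t) = - polytabloid T t.
Proof.
move=> nab cab; have ctau x : col T (tperm a b x) = col T x.
  by case: tpermP => [->|->|].
rewrite !polytabloidE -sumrN (reindex_inj (mulgI (tperm a b))) /=.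
apply: eq_big => [s|s _].
  rewrite !inE; apply/forallP/forallP=> stab x; apply/eqP/val_inj.
    have /eqP/(congr1 val) := stab (tperm a b x).
    by rewrite permM tpermK => ->; apply: ctau.
  have /eqP/(congr1 val) := stab (tperm a b x).
  by rewrite permM => ->; apply: ctau.
rewrite odd_permM odd_tperm nab signr_addb expr1 mulN1r mulrN; congr (- (_%:R * _)).
have -> : tabloid_of (tableau_act (tperm a b * s)%g T) =
     tabloid_act (tperm a b) (tabloid_of (tableau_act s T)).
  by apply/val_inj/ffunP=> i; rewrite /= !ffunE /= ?ffunE permM.
rewrite (inj_eq (can_inj (_ : cancel _ (tabloid_act (tperm a b))))) //.
by move=> u; rewrite -tabloid_actM tperm2 tabloid_act1.
Qed.

(** Only the identity preserves both the row and the column of every letter. *)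
Lemma polytabloid_diag T : polytabloid T (tabloid_of T) = 1.
Proof.
rewrite polytabloidE (bigD1 1%g) /=; last first.
  by rewrite inE; apply/forallP=> i; rewrite perm1.
have -> : tableau_act 1%g T = T by apply/val_inj/ffunP=> i; rewrite /= ffunE perm1.
rewrite eqxx odd_perm1 mulr1 big1 ?addr0 // => s /andP[]; rewrite inE => /forallP stab ns.
case: eqP => [e|]; rewrite ?mul0r //.
case/eqP: ns; apply/permP=> i; rewrite perm1.
apply: (@cell_inj T); last exact/(congr1 val)/eqP/stab.
have := congr1 (fun u : tabloid n la => val (val u i)) e.
by rewrite /= !ffunE /= ?ffunE => /esym.
Qed.

(** The columns of length two, each listed from top to bottom. *)
Definition columns_of T (s : seq ('I_n * 'I_n)) :=
  [/\ size s = k, uniq (letters s) &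
      {in s, forall ab, [/\ row T ab.1 = 0%N, row T ab.2 = 1%N & col T ab.1 = col T ab.2]}].

(** Both sides change sign when a pair of [s] is exchanged.  So both vanish at
    a tabloid that has a pair in a single row, and otherwise exchanges bring
    the tabloid to that of [T], where both sides are 1. *)
Lemma polytabloid_colprod T s t : columns_of T s ->
  polytabloid T t = colprod s (rowset t).
Proof.
case=> ss us colP; have us2 : uniq (unzip2 s) by move: us; rewrite cat_uniq => /and3P[].
have us1 : uniq s by exact: map_uniq us2.
have [m] := ubnP #|rowset t :\: row_set T 1|; elim: m t => // m IH t; rewrite ltnS => le_m.
have swapE a b : rowset (tabloid_act (tperm a b) t) = tperm a b @: rowset t.
  by rewrite rowset_act tpermV.
have nab a b : (a, b) \in s -> a != b.
  by case/colP => /= ra rb _; apply/eqP => e; rewrite e rb in ra.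
case: (boolP (has (fun ab => (ab.1 \in rowset t) == (ab.2 \in rowset t)) s)).
  case/hasP=> -[a b] abs /= /eqP e; have [_ _ cab] := colP _ abs.
  have zero (x : int) : x = - x -> x = 0.
    by move/eqP; rewrite -subr_eq0 opprK -mulr2n mulrn_eq0 => /eqP.
  have ft : tabloid_act (tperm a b) t = t.
    apply: rowset_inj; rewrite swapE; apply/setP=> x.
    rewrite -[x in LHS](tpermK a b) mem_imset; last exact: perm_inj.
    by case: tpermP => [->|->|//]; rewrite e.
  transitivity (0 : int); first by apply: zero; rewrite -{1}ft polytabloid_swap ?nab.
  by symmetry; apply: zero; rewrite -{1}ft swapE colprod_swap.
move/hasPn => trans.
case: (boolP (has (fun ab => ab.1 \in rowset t) s)).
  case/hasP=> -[a b] abs /= at_; have [/= ra rb cab] := colP _ abs.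
  have bt : b \notin rowset t by have := trans _ abs; rewrite /= at_; case: (b \in _).
  apply: oppr_inj; rewrite -(polytabloid_swap t (nab _ _ abs) cab).
  rewrite -(colprod_swap _ us abs) -swapE; apply: IH.
  apply: leq_trans le_m; apply: proper_card; apply/properP; split.
    apply/subsetP=> x; rewrite swapE !in_setD -{2}[x](tpermK a b) mem_imset; last exact: perm_inj.
    by case: tpermP => [->|->|//]; rewrite ?(negbTE bt) ?andbF // inE rb.
  exists a; first by rewrite in_setD at_ inE ra.
  by rewrite swapE in_setD -{2}[a](tpermR a b) mem_imset ?(negbTE bt) ?andbF //; exact: perm_inj.
move/hasPn => none.
have all2 b : b \in unzip2 s -> b \in rowset t.
  case/mapP=> -[a b'] abs /= ->; have := trans _ abs; have := none _ abs => /= /negbTE->.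
  by case: (b' \in _).
have all2T b : b \in unzip2 s -> b \in row_set T 1.
  by case/mapP=> -[a b'] /colP[/= _ rb _] ->; rewrite inE rb.
have c2 : #|[set x in unzip2 s]| = k.
  have -> : #|[set x in unzip2 s]| = size (unzip2 s) by rewrite cardsE; apply/card_uniqP.
  by rewrite size_map.
have e1 : [set x in unzip2 s] = rowset t.
  apply/eqP; rewrite eqEcard c2 card_rowset leqnn andbT.
  by apply/subsetP=> x; rewrite inE => /all2.
have e2 : [set x in unzip2 s] = row_set T 1.
  apply/eqP; rewrite eqEcard c2 (card_row T).1 leqnn andbT.
  by apply/subsetP=> x; rewrite inE => /all2T.
have -> : t = tabloid_of T by apply: rowset_inj; rewrite rowset_tabloid_of -e1.
rewrite polytabloid_diag rowset_tabloid_of -e2 e1 ffunE card_rowset ss eqxx mul1r.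
rewrite big_seq big1 //.
move=> ab abs; rewrite (negbTE (none _ abs)) all2 ?subr0 //; exact: map_f.
Qed.

Lemma columns_exist T : exists s, columns_of T s.
Proof.
have [c1 c0] := card_row T.
have above b : exists a, b \in row_set T 1 -> row T a = 0%N /\ col T a = col T b.
  case: (boolP (b \in row_set T 1)) => [|_]; last by exists b.
  rewrite inE => /eqP rb.
  have [|a ra ca] := @row0_surj T (col T b); last by exists a.
  by case: (cellP T b) => -[]; rewrite rb // => _ lt; lia.
have [f fP] := boolp.choice above.
exists [seq (f b, b) | b <- enum (row_set T 1)]; split.
- by rewrite size_map -cardE.
- rewrite /letters /unzip1 /unzip2 -!map_comp.
  rewrite -[[seq _ | b <- _] in X in _ ++ X]/(map id (enum (row_set T 1))) map_id.
  rewrite cat_uniq enum_uniq andbT.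
  apply/andP; split.
    rewrite map_inj_in_uniq ?enum_uniq // => b b'; rewrite !mem_enum => bT bT' /= e.
    have [_ cb] := fP b bT; have [_ cb'] := fP b' bT'.
    apply: (@cell_inj T); last by rewrite -cb -cb' e.
    by move: bT bT'; rewrite !inE => /eqP-> /eqP->.
  apply/hasPn=> b; rewrite mem_enum inE => /eqP rb; apply/mapP=> -[b' /=].
  by rewrite mem_enum => /fP[rf _] e; rewrite e rf in rb.
move=> _ /mapP[b + ->] /=; rewrite mem_enum => bT; have [] := fP b bT.
by move: bT; rewrite inE => /eqP.
Qed.

Lemma tableau_of_columns s : size s = k -> uniq (letters s) -> exists T, columns_of T s.
Proof.
move=> ss us.
pose l1 := unzip2 s; pose rest := [seq i <- enum 'I_n | i \notin letters s].
have u1 : uniq (unzip1 s) by move: us; rewrite cat_uniq => /and3P[].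
have u2 : uniq (unzip2 s) by move: us; rewrite cat_uniq => /and3P[].
have d12 i : i \in unzip1 s -> i \notin unzip2 s.
  by move: us; rewrite cat_uniq => /and3P[_ /hasPn h _] i1; apply/negP => /h /=; rewrite i1.
have ul : uniq ((unzip1 s ++ rest) ++ l1).
  rewrite -catA (perm_uniq (_ : perm_eq _ (letters s ++ rest))); last first.
    by rewrite /letters -catA perm_cat2l perm_catC.
  rewrite cat_uniq us filter_uniq ?enum_uniq // andbT /=.
  by apply/hasPn=> i; rewrite mem_filter => /andP[].
have srest : size rest = (n - 2 * k)%N.
  have : (count (mem (letters s)) (enum 'I_n) + size rest = n)%N.
    by rewrite size_filter count_predC -cardE card_ord.
  have -> : count (mem (letters s)) (enum 'I_n) = size (letters s).
    rewrite -size_filter; apply/perm_size/uniq_perm => //; first by rewrite filter_uniq ?enum_uniq.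
    by move=> i; rewrite mem_filter mem_enum andbT.
  by rewrite size_cat !size_map ss; lia.
have [|||T [T0 T1]] := @tableau_of_rows (unzip1 s ++ rest) l1.
- exact: ul.
- by rewrite size_cat size_map srest ss; lia.
- by rewrite size_map.
exists T; split=> // -[a b] abs /=.
have a1 : a \in unzip1 s by apply/mapP; exists (a, b).
have b2 : b \in unzip2 s by apply/mapP; exists (a, b).
have [|-> ->] := T0 a; first by rewrite mem_cat a1.
have [-> ->] := T1 b b2; split=> //.
rewrite index_cat a1.
have lt_ab : (index (a, b) s < size s)%N by rewrite index_mem.
have -> : index a (unzip1 s) = index (a, b) s.
  rewrite -[RHS](index_uniq a _ u1) ?size_map //.
  by rewrite (nth_map (a, b)) ?nth_index.
rewrite -[LHS](index_uniq b _ u2) ?size_map //.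
by rewrite (nth_map (a, b)) ?nth_index.
Qed.

Lemma to_sets_rowset (x : specht_sort n la) t : to_sets x (rowset t) = val x t.
Proof.
rewrite ffunE (bigD1 t) //= big1 ?addr0 // => u /andP[/eqP/rowset_inj->].
by rewrite eqxx.
Qed.

Lemma to_sets_homog (x : specht_sort n la) : homog k (to_sets x : V).
Proof.
move=> B nB; rewrite ffunE big1 // => t /eqP e.
by rewrite -e card_rowset eqxx in nB.
Qed.

Lemma to_sets_inj : injective (@to_sets n la).
Proof.
by move=> x y e; apply/val_inj/ffunP=> t; rewrite -!to_sets_rowset e.
Qed.

Lemma rowset_surj B : #|B| = k -> exists t, rowset t = B.
Proof.
move=> cB; have sB : size (enum B) = k by rewrite -cardE.
have [|||T [T0 T1]] := @tableau_of_rows (enum (~: B)) (enum B) _ _ _.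
- rewrite cat_uniq !enum_uniq andbT /=; apply/hasPn=> i.
  by rewrite !mem_enum inE => ->.
- by rewrite -cardE cardsCs setCK cB card_ord.
- by [].
exists (tabloid_of T); rewrite rowset_tabloid_of; apply/setP=> i; rewrite inE.
case: (boolP (i \in B)) => iB; first by rewrite (T1 i _).1 ?mem_enum.
by rewrite (T0 i _).1 ?mem_enum ?inE.
Qed.

Lemma to_sets_act g (x : specht n la) : to_sets (gact g x) = set_act g (to_sets x).
Proof.
have gK : cancel (tabloid_act g) (@tabloid_act n la g^-1).
  by move=> t; rewrite -tabloid_actM mulVg tabloid_act1.
apply/ffunP=> B; rewrite !ffunE (reindex_inj (can_inj gK)).
apply: eq_big => [t|t _]; last first.
  by rewrite /= ffunE -tabloid_actM mulVg tabloid_act1.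
rewrite rowset_act; apply/eqP/eqP => [<-|->].
  by rewrite -imset_permM mulVg imset_perm1.
by rewrite -imset_permM mulgV imset_perm1.
Qed.

Definition polytabloid_elt T : specht_sort n la.
Proof.
exists (polytabloid T); apply/asboolP; exists (fun T' => (T' == T)%:Z).
rewrite (bigD1 T) //= eqxx mulr1z big1 ?addr0 // => T' /negbTE->.
by rewrite mulr0z.
Defined.

Lemma to_sets_polytabloid T s : columns_of T s -> to_sets (polytabloid_elt T) = colprod s.
Proof.
move=> cs; apply/ffunP=> B; case: (altP (#|B| =P k)) => [/rowset_surj[t <-]|nB].
  by rewrite to_sets_rowset; exact: polytabloid_colprod.
by rewrite to_sets_homog // homog_colprod //; case: cs => ->.
Qed.

(** The Specht module lies in the kernel, as polytabloids are products of
    differences. *)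
Lemma down_to_sets (x : specht_sort n la) : down (to_sets x : V) = 0.
Proof.
case/asboolP: (valP x) => c xE.
have -> : x = \sum_T polytabloid_elt T *~ c T.
  apply: val_inj; rewrite xE raddf_sum; apply: eq_bigr => T _.
  by rewrite raddfMz.
rewrite !raddf_sum big1 // => T _; rewrite !raddfMz /=.
have [s cs] := columns_exist T; rewrite (to_sets_polytabloid cs).
by rewrite down_colprod ?mul0rz //; case: cs.
Qed.

(** The Specht module is the whole kernel: each product of [k] differences is a
    polytabloid. *)
Lemma to_sets_image f : homog k f -> down f = 0 -> exists x : specht_sort n la, to_sets x = f.
Proof.
move=> hf df; have : col_span setT k f.
  by apply: kernel_down_span => //; rewrite cardsT card_ord.
elim=> [|g c s _ [x <-] ss us _]; first by exists 0; rewrite raddf0.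
have [T cs] := tableau_of_columns ss us.
by exists (x + polytabloid_elt T *~ c); rewrite raddfD raddfMz /= (to_sets_polytabloid cs).
Qed.

End TwoRowSpecht.

(** * The second cohomology of two-row Specht modules *)

Section TwoRowCohomology.
Import GRing.Theory Num.Theory.
Local Open Scope ring_scope.
Variables n d : nat.
Hypotheses (n_gt1 : (1 < n)%N) (le_2k_n : (2 * d.+1 <= n)%N).
Local Notation S := (specht n [:: (n - d.+1)%N; d.+1]).
Local Notation M := (set_module n int).
Local Notation phi := (@to_sets n [:: (n - d.+1)%N; d.+1]).
Local Notation dn := (@down n).

Lemma phi_cobound1 (f : {ffun 'S_n -> S}) :
  push phi (cobound1 f) = cobound1 (push phi f : {ffun 'S_n -> M}).
Proof. exact: (@push_cobound1 _ S M phi (@to_sets_act n d.+1)). Qed.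

Lemma phi_cobound2 (f : {ffun 'S_n * 'S_n -> S}) :
  push phi (cobound2 f) = cobound2 (push phi f : {ffun 'S_n * 'S_n -> M}).
Proof. exact: (@push_cobound2 _ S M phi (@to_sets_act n d.+1)). Qed.

Lemma down_cobound0 (u : M) : push dn (cobound0 u) = cobound0 (dn u : M).
Proof. exact: (@push_cobound0 _ M M dn (@down_act n)). Qed.

Lemma down_cobound1 (f : {ffun 'S_n -> M}) :
  push dn (cobound1 f) = cobound1 (push dn f : {ffun 'S_n -> M}).
Proof. exact: (@push_cobound1 _ M M dn (@down_act n)). Qed.

Lemma homog_part_cobound0 j (u : M) :
  push (@homog_part n j) (cobound0 u) = cobound0 (homog_part j u : M).
Proof. exact: (@push_cobound0 _ M M (@homog_part n j) (@homog_part_act n j)). Qed.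

Lemma homog_part_cobound1 j (f : {ffun 'S_n -> M}) :
  push (@homog_part n j) (cobound1 f) = cobound1 (push (@homog_part n j) f : {ffun 'S_n -> M}).
Proof. exact: (@push_cobound1 _ M M (@homog_part n j) (@homog_part_act n j)). Qed.

(** A cocycle with values in the Specht module, seen in the lattice of functions
    on sets. *)
Definition ambient (z : Z2 S) : {ffun 'S_n * 'S_n -> M} := push phi (val z).

Lemma ambientB y z : ambient (y - z) = ambient y - ambient z.
Proof. by rewrite /ambient !raddfB. Qed.

Lemma ambientMn z m : ambient (z *+ m) = ambient z *+ m.
Proof. by rewrite /ambient !raddfMn. Qed.

Lemma ambientMz z m : ambient (z *~ m) = ambient z *~ m.
Proof. by rewrite /ambient !raddfMz. Qed.

Lemma push_phi_inj (T : finType) : injective (push phi : {ffun T -> S} -> {ffun T -> M}).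
Proof.
move=> x y e; apply/ffunP=> t; apply: (@to_sets_inj n d.+1).
by have := congr1 (fun f : {ffun T -> M} => f t) e; rewrite !ffunE.
Qed.

Lemma lift_specht (T : finType) (F : {ffun T -> M}) :
  (forall t, homog d.+1 (F t)) -> push dn F = 0 ->
  exists F' : {ffun T -> S}, push phi F' = F.
Proof.
move=> hF dF.
have /choice[F' F'E] t : exists x : specht_sort n [:: (n - d.+1)%N; d.+1], to_sets x = F t.
  apply: (to_sets_image n_gt1 le_2k_n) => //.
  by have := congr1 (fun f : {ffun T -> M} => f t) dF; rewrite !ffunE.
by exists [ffun t => F' t]; apply/ffunP=> t; rewrite !ffunE F'E.
Qed.

Lemma ambient_cocycle z : cobound2 (ambient z) = 0.
Proof.
rewrite -phi_cobound2.
by have /eqP -> := valP z; rewrite raddf0.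
Qed.

Lemma lift_cocycle (w : {ffun 'S_n * 'S_n -> M}) :
  (forall t, homog d.+1 (w t)) -> push dn w = 0 -> cobound2 w = 0 ->
  exists z, ambient z = w.
Proof.
move=> hw dw cw; have [w' w'E] := lift_specht hw dw.
have cw' : w' \in @cocycle2 _ S.
  apply/eqP/push_phi_inj; rewrite phi_cobound2 w'E cw.
  by rewrite raddf0.
by exists (Sub w' cw'); rewrite /ambient SubK.
Qed.

Lemma H2class_vanish (z : Z2 S) (F : {ffun 'S_n -> M}) :
  (forall g, homog d.+1 (F g)) -> push dn F = 0 -> ambient z = cobound1 F ->
  H2class z = 0.
Proof.
move=> hF dF zF; have [F' F'E] := lift_specht hF dF.
apply/H2class_eq0; exists F'; apply: push_phi_inj.
by rewrite phi_cobound1 F'E.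
Qed.

Lemma down_phi (T : finType) (F : {ffun T -> S}) : push dn (push phi F : {ffun T -> M}) = 0.
Proof. by apply/ffunP=> t; rewrite !ffunE (down_to_sets n_gt1 le_2k_n). Qed.

Lemma homog_phi (T : finType) (F : {ffun T -> S}) t : homog d.+1 ((push phi F : {ffun T -> M}) t).
Proof. rewrite ffunE; exact: (to_sets_homog n_gt1 le_2k_n). Qed.

Lemma homog_crossed j (f : {ffun 'S_n -> M}) : (forall g, homog j (f g)) ->
  cobound1 f = 0 -> exists2 u : M, homog j u & f *+ 2 = cobound0 u.
Proof.
move=> hf /crossed_hom[u uE]; exists (homog_part j u); first exact: homog_partP.
rewrite -homog_part_cobound0 -uE raddfMn; congr (_ *+ _).
by apply/ffunP=> g; rewrite ffunE /= homog_part_id //; exact: hf.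
Qed.

(** The two connecting maps: [f] bounds [2 z] among all functions, so [down f]
    is a crossed homomorphism and twice it is principal, with potential [u]. *)
Lemma twice_cocycle z : exists (f : {ffun 'S_n -> M}) (u : M),
  [/\ forall g, homog d.+1 (f g), homog d u,
      ambient z *+ 2 = cobound1 f & push dn f *+ 2 = cobound0 u].
Proof.
have [f0 f0E] := crossed_cocycle n_gt1 (ambient_cocycle z).
pose f : {ffun 'S_n -> M} := push (@homog_part n d.+1) f0.
have hf g : homog d.+1 (f g) by rewrite ffunE; exact: homog_partP.
have fE : ambient z *+ 2 = cobound1 f.
  rewrite -homog_part_cobound1 -f0E raddfMn; congr (_ *+ _).
  by apply/ffunP=> t; rewrite [RHS]ffunE /= homog_part_id //; exact: homog_phi.
have [||u hu uE] := @homog_crossed d (push dn f).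
- by move=> g; rewrite ffunE; apply: homog_down; exact: hf.
- by rewrite -down_cobound1 -fE raddfMn /= down_phi mul0rn.
by exists f, u.
Qed.

Lemma H2_order (z : Z2 S) : H2class z *+ #|'S_n| = 0.
Proof.
rewrite -raddfMn; apply/H2class_eq0; exists [ffun g => \sum_k val z (g, k)].
by rewrite cocycle_sum ?raddfMn //; apply/eqP/(valP z).
Qed.

(** Reducing representatives modulo the order [N] of the group is injective on
    classes: if a cocycle is divisible by [N] in the ambient functions, the
    quotient again takes values in the kernel of [down], hence in the Specht
    module, and [N] kills its class. *)
Lemma H2_finite : exists m, finite_order (H2 S) m.
Proof.
have /choice[rep repP] := @H2class_surj _ S; set N := #|'S_n|.
have N_gt1 : (1 < N)%N by exact: card_perm_gt1.
apply: (@finite_order_inj _ _ (fun x => push (@reduce n N) (ambient (rep x)))) => x y e.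
rewrite -[x]repP -[y]repP; apply/eqP; rewrite -subr_eq0 -raddfB.
set z := _ - _.
have /choice[v vE] t : exists v : M, ambient z t = v *+ N.
  apply: reduce_eq0 => //; rewrite ambientB !ffunE raddfB /=.
  have := congr1 (fun f : {ffun _ -> {ffun {set 'I_n} -> 'Z_N}} => f t) e.
  by rewrite !ffunE => ->; rewrite subrr.
pose w : {ffun 'S_n * 'S_n -> M} := [ffun t => v t].
have zw : ambient z = w *+ N by apply/ffunP=> t; rewrite vE ffunMnE ffunE.
have N_gt0 := ltnW N_gt1.
have tf (u : M) : u *+ N = 0 -> u = 0.
  move=> uN; apply/ffunP=> B; rewrite [RHS]ffunE; apply: (pmulrnI N_gt0).
  by rewrite mul0rn -ffunMnE uN ffunE.
have tff (T : finType) (u : {ffun T -> M}) : u *+ N = 0 -> u = 0.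
  move=> uN; apply/ffunP=> t; rewrite [RHS]ffunE; apply: tf.
  by rewrite -ffunMnE uN ffunE.
have [|||z' z'E] := @lift_cocycle w.
- move=> t B nB; apply: (pmulrnI N_gt0); rewrite mul0rn ffunE -ffunMnE -vE.
  exact: homog_phi.
- by apply: tff; rewrite -raddfMn -zw; exact: down_phi.
- by apply: tff; rewrite -raddfMn -zw; exact: ambient_cocycle.
have -> : z = z' *+ N.
  by apply/val_inj/push_phi_inj; rewrite -/(ambient _) zw -z'E -ambientMn.
by rewrite raddfMn H2_order.
Qed.

(** If the potential [u] of [twice_cocycle] is, up to a factor [m] prime to [p]
    and a constant function, in the image of [down], then [f] can be corrected to
    take values in the Specht module, so [4 * m] kills the class.  The 4
    collects the two applications of vanishing up to 2. *)
Lemma H2_no_torsion p : prime p -> (2 < p)%N ->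
  (forall u : M, homog d u -> exists m c (x : M),
     [/\ coprime p m, homog d.+1 x & u *+ m = dn x + const_on n d *~ c]) ->
  forall x : H2 S, x *+ p = 0 -> x = 0.
Proof.
move=> p_pr p_gt2 img x px; have [z zE] := H2class_surj x.
have [f [u [hf hu zf fu]]] := twice_cocycle z.
have [m [c [y [cpm hy uy]]]] := img u hu.
pose F : {ffun 'S_n -> M} := f *+ (2 * m) - cobound0 (y : M).
have c0 : cobound0 (const_on n d : M) = 0.
  by apply/ffunP=> g; rewrite !ffunE /= const_on_act subrr.
have : H2class (z *+ (4 * m)) = 0.
  apply: (@H2class_vanish _ F).
  - move=> g; rewrite !ffunE ffunMnE; apply: homogB; first exact: homogMn.
    by apply: homogB => //; apply: homog_act.
  - have dy : dn y = u *+ m - const_on n d *~ c by rewrite uy addrK.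
    rewrite raddfB raddfMn /= mulrnA fu down_cobound0 dy raddfB raddfMn raddfMz /=.
    by rewrite c0 mul0rz subr0 subrr.
  - rewrite ambientMn raddfB raddfMn /= cobound10 subr0 -zf -mulrnA.
    by congr (_ *+ _); lia.
rewrite raddfMn /= zE => x4m; apply: (@coprime_torsion _ _ p (4 * m)) => //.
rewrite coprimeMr cpm andbT prime_coprime // -[4%N]/(2 ^ 2)%N Euclid_dvdX // andbT.
by rewrite gtnNdvd.
Qed.

Lemma prime_coprime_fact p m : prime p -> (m < p)%N -> coprime p m`!.
Proof.
move=> p_pr; elim: m => [|m IH] lt_mp; first by rewrite fact0 coprimen1.
by rewrite factS coprimeMr IH 1?ltnW // andbT prime_coprime // gtnNdvd.
Qed.

(** The class [x0] comes from the potential [u0], a basis vector of total 1: by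
    [image_total0] the crossed homomorphism of [u0 *+ m0] is [down f0], and [x0] is
    the class of the coboundary of [f0].  If it were zero, a multiple of [u0] prime
    to [p] would differ from an image of [down] by a constant function;
    comparing totals modulo [p] excludes this, since binomial(n, p-1) is
    divisible by [p].  For any other cocycle, subtracting [u0 *~ a], with [a] the
    total of its potential, leaves a potential in the image of [down] up to
    [m0]; so [4 * m0] times its class is [a] times [x0]. *)
Lemma H2_generator : prime d.+1 -> (2 < d.+1)%N -> (d.+1 %| n)%N ->
  exists x0 : H2 S, [/\ x0 != 0, x0 *+ d.+1 = 0 &
    forall x, x *+ d.+1 = 0 -> exists z, x = x0 *~ z].
Proof.
move=> p_pr p_gt2 p_dvd; set p := d.+1 in p_pr p_gt2 p_dvd *; pose m0 := d`!%N.
have le_d : (2 * d + 1 <= n)%N by lia.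
have cop2 : coprime p 2 by rewrite prime_coprime // gtnNdvd.
have cop : coprime p m0 by exact: prime_coprime_fact.
have [A0 cA0] : exists A0 : {set 'I_n}, #|A0| = d by apply: set_of_card; lia.
pose u0 : M := set_basis A0.
have hu0 : homog d u0 by rewrite -cA0; exact: homog_basis.
have /choice[f0' f0'E] g : exists x : M, homog p x /\ dn x = (gact g u0 - u0) *+ m0.
  have [|||x hx <-] := @image_total0 n d (gact g u0 - u0); last by exists x.
  - by apply: homogB => //; apply: homog_act.
  - exact: le_d.
  - by rewrite raddfB /= total_act subrr.
pose f0 : {ffun 'S_n -> M} := [ffun g => f0' g].
have hf0 g : homog p (f0 g) by rewrite ffunE; case: (f0'E g).
have df0 : push dn f0 = cobound0 (u0 *+ m0 : M).
  rewrite raddfMn /=; apply/ffunP=> g; rewrite ffunMnE !ffunE.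
  by case: (f0'E g).
clearbody f0.
have [|||z0 z0E] := @lift_cocycle (cobound1 f0).
- move=> -[g h]; rewrite ffunE; apply: homogD => //; apply: homogB => //.
  exact: homog_act.
- by rewrite down_cobound1 df0 cobound10.
- exact: cobound21.
exists (H2class z0); split.
- apply/eqP => /H2class_eq0[f' f'E].
  have [g||v hv vE] := @homog_crossed p (f0 - push phi f').
  + by rewrite ffunE [X in _ + X]ffunE; apply: homogB => //; apply: homog_phi.
  + by rewrite raddfB /= -z0E -phi_cobound1 -f'E subrr.
  have inv g : set_act g (u0 *+ m0 *+ 2 - dn v) = u0 *+ m0 *+ 2 - dn v.
    apply/eqP; rewrite -subr_eq0; apply/eqP.
    have : cobound0 (u0 *+ m0 *+ 2 - dn v : M) = 0.
      rewrite raddfB raddfMn /= -df0 -down_cobound0 -vE raddfMn raddfB /= down_phi.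
      by rewrite subr0 subrr.
    by move/(congr1 (fun f : {ffun _ -> M} => f g)); rewrite !ffunE.
  have [|c cE] := @invariant_const n d (u0 *+ m0 *+ 2 - dn v) _ inv.
    by apply: homogB; [do 2! apply: homogMn | exact: homog_down].
  have := congr1 (@total n) cE.
  rewrite raddfB !raddfMn raddfMz /= total_basis (total_down hv) total_const_on => tE.
  have /dvdnP[q qE] : (p %| 'C(n, d))%N.
    have d_gt0 : (0 < d)%N by lia.
    have copd : coprime p d by rewrite prime_coprime // gtnNdvd.
    have := mul_bin_diag n d.-1; rewrite prednK // => binE.
    by rewrite -(Gauss_dvdr _ copd) -binE dvdn_mulr.
  have : (p %| m0 * 2)%N.
    suff : (p %| Posz (m0 * 2))%Z by [].
    apply/dvdzP; exists (total v + c * q%:Z).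
    have -> : Posz (m0 * 2) = 'C(n, d)%:Z *~ c + total v *+ p.
      by move/eqP: tE; rewrite subr_eq -mulrnA !natz => /eqP.
    rewrite qE PoszM -mulrzr intz -[total v *+ p]mulr_natr natz; ring.
  rewrite Euclid_dvdM // => /orP[]; apply/negP; rewrite -prime_coprime //.
- have [|x1 [hx1 _] x1E] := @image_basis n A0 setT (subsetT _).
    by rewrite cardsT card_ord cA0.
  rewrite -raddfMn /=; apply: (@H2class_vanish _ (f0 *+ p - cobound0 (x1 : M))).
  + move=> g; rewrite !ffunE ffunMnE; apply: homogB; first exact: homogMn.
    by rewrite cA0 in hx1; apply: homogB => //; apply: homog_act.
  + rewrite raddfB raddfMn /= df0 down_cobound0 x1E cA0 !raddfMn /= -mulrnA.
    by rewrite factS mulNrn mulnC subrr.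
  + by rewrite ambientMn z0E raddfB raddfMn /= cobound10 subr0.
move=> x px; have [z zE] := H2class_surj x.
have [f [u [hf hu zf fu]]] := twice_cocycle z.
pose a := total u.
have [|||y hy yE] := @image_total0 n d (u - u0 *~ a).
- by apply: homogB => //; apply: homogMz.
- exact: le_d.
- by rewrite raddfB raddfMz /= total_basis -mulrzl mulr1 intz subrr.
pose F : {ffun 'S_n -> M} := f *+ (2 * m0) - cobound0 (y : M) - f0 *~ a.
have x4 : x *+ (4 * m0) = H2class z0 *~ a.
  rewrite -zE -raddfMn -raddfMz /=; apply/eqP; rewrite -subr_eq0 -raddfB; apply/eqP.
  apply: (@H2class_vanish _ F).
  - move=> g; rewrite !ffunE ffunMnE ffunMzE; apply: homogB; last exact: homogMz.
    apply: homogB; first exact: homogMn.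
    by apply: homogB => //; apply: homog_act.
  - have dy : dn y = u *+ m0 - u0 *+ m0 *~ a by rewrite yE mulrnBl !pmulrn mulrzAC.
    rewrite /F !raddfB raddfMn raddfMz /= mulrnA fu df0 down_cobound0 dy.
    rewrite [cobound0 (_ - _)]raddfB /= [cobound0 (_ *~ _)]raddfMz /=.
    by rewrite [cobound0 (u *+ m0)]raddfMn /= subKr subrr.
  rewrite ambientB ambientMn ambientMz z0E /F !raddfB raddfMn /= cobound10 subr0.
  by rewrite [cobound1 (f0 *~ a)]raddfMz -zf -mulrnA; congr (_ *+ _ - _); lia.
have c4 : coprime p (4 * m0) by rewrite coprimeMr cop -[4%N]/(2 ^ 2)%N coprimeXr.
have [c _ /dvdnP[q e]] := Bezoutl (4 * m0) (ltn0Sn d).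
(* [c] inverts [- 4 * m0] modulo [p]. *)
exists (- (a * c%:Z)); have := congr1 (GRing.natmul x) e.
rewrite (eqP c4) mulrnDr mulr1n (mulnC c) (mulnC q) mulrnA x4 mulrnA px mul0rn.
move/eqP; rewrite addr_eq0 => /eqP->.
by rewrite mulrNz mulrzA pmulrn.
Qed.

End TwoRowCohomology.

(** * Shapes without p-torsion, and the theorem *)

Section Vanishing.
Import GRing.Theory Num.Theory.
Local Open Scope ring_scope.

Lemma H2_no_torsion_small n d p : (1 < n)%N -> (2 * d.+1 <= n)%N ->
  prime p -> (2 < p)%N -> (d.+1 < p)%N ->
  forall x : H2 (specht n [:: (n - d.+1)%N; d.+1]), x *+ p = 0 -> x = 0.
Proof.
move=> n_gt1 le_2k p_pr p_gt2 lt_dp; apply: H2_no_torsion => // u hu.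
have [|x hx xE] := image_factorial hu; first by lia.
exists d.+1`!, 0, x; split=> //; first exact: prime_coprime_fact.
by rewrite mulr0z addr0 -xE.
Qed.

(** Modulo [p], the factors of the falling factorial of [n] are -1, ..., -(p-1). *)
Lemma coprime_bin_pred p n : prime p -> (p <= n)%N -> (p %| n.+1)%N ->
  coprime p 'C(n, p.-1).
Proof.
move=> p_pr le_pn p_dvd; have p_gt1 := prime_gt1 p_pr.
suff : coprime p (n ^_ p.-1) by rewrite -bin_ffact coprimeMr => /andP[].
rewrite ffact_prod; elim/big_ind: _ => [|a b ca cb|i _]; first by rewrite coprimen1.
  by rewrite coprimeMr ca.
rewrite prime_coprime //; apply/negP => p_dvd_i; have := ltn_ord i => lt_i.
have : (p %| i.+1)%N.
  by rewrite -(dvdn_addr _ p_dvd_i) addnS subnK //; lia.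
by rewrite gtnNdvd //; lia.
Qed.

(** As binomial(n, d) is invertible modulo [d + 1], subtracting a constant function
    from a potential makes its total divisible by [d + 1]. *)
Lemma H2_no_torsion_pred n d : prime d.+1 -> (2 < d.+1)%N -> (2 * d.+1 <= n)%N ->
  (d.+1 %| n.+1)%N ->
  forall x : H2 (specht n [:: (n - d.+1)%N; d.+1]), x *+ d.+1 = 0 -> x = 0.
Proof.
move=> p_pr p_gt2 le_2k p_dvd; apply: H2_no_torsion => //; first by lia.
move=> u hu; have cop : coprime d.+1 'C(n, d) by apply: (@coprime_bin_pred d.+1) => //; lia.
have [b _ bE] := Bezoutl 'C(n, d) (ltn0Sn d).
have /dvdnP[q {}bE] := bE; rewrite (eqP cop) in bE.
(* Here [- b] inverts the binomial coefficient modulo [d.+1]. *)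
pose c := - (total u * b%:Z).
have hv : homog d (u - const_on n d *~ c).
  by apply: homogB => //; apply: homogMz; exact: homog_const_on.
have [||x hx xE] := image_total_dvd hv; first by lia.
  rewrite raddfB raddfMz /= total_const_on; apply/dvdzP; exists (total u * q%:Z).
  have {}bE : 1 + b%:Z * 'C(n, d)%:Z = q%:Z * d.+1%:Z by rewrite -!PoszM -bE.
  rewrite /c natz -mulrzr intz -mulrA -bE; ring.
exists d`!, (c * d`!%:Z), x; split=> //; first exact: prime_coprime_fact.
rewrite xE mulrnBl mulrzA -pmulrn subrK //.
Qed.

End Vanishing.

Theorem lemma6p7 (p n : nat) (p_prime : prime p) (p_gt2 : 2 < p)
    (n_ge2p : 2 * p <= n) (p_dvd_n : p %| n) :
  let la := [:: n - p; p] in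
  [/\ in_C2 p la,
      p_rank_is p (H2 (specht n la)) 1
    & ~ exists mu : seq nat, predecessor p mu la].
Proof.
move=> la; rewrite {}/la.
(* Both second rows that occur, [p] and [p - 1], become successors. *)
case: p => // -[|e] // in p_prime p_gt2 n_ge2p p_dvd_n *.
have n_gt1 : 1 < n by lia.
have [x0 [nx0 px0 gen]] := H2_generator n_gt1 n_ge2p p_prime p_gt2 p_dvd_n.
split.
- exists n; split.
    by rewrite /is_partition /= !inE /= !andbT; apply/and3P; split; lia.
  have [m Hm] := H2_finite n_gt1 n_ge2p; exists m => //.
  by apply/(finite_order_dvd p_prime Hm); exists x0.
- exact: p_rank1 px0 gen.
case=> mu [[n' [/and3P[mu_sorted mu0 mu_sum] [m Hm p_dvd_m]]] _ [i la_mu]].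
have {m Hm p_dvd_m} [x nx px] := (finite_order_dvd p_prime Hm).1 p_dvd_m.
(* Only a shape with two nonzero rows can give [:: n - p; p], as [p > 1]. *)
case: mu => [|a [|b [|c mu]]] in mu_sorted mu0 mu_sum la_mu x nx px *.
- by case: i la_mu => [|[|i]] //= [].
- by case: i la_mu => [|[|i]] //= [].
- move: mu_sorted mu_sum; rewrite /= andbT addn0 => le_ba /eqP sum_ab.
  have lt_i2 : i < 2.
    have := congr1 size la_mu; rewrite size_incr_nth /=.
    by case: ltnP => // le_2i [ei]; rewrite -ei in le_2i.
  case: i la_mu lt_i2 => [|[|i]] //= [e1 e2] _.
    rewrite -e2 in le_ba sum_ab x nx px.
    have aE : a = n' - e.+2 by lia.
    rewrite aE in x nx px; case/eqP: nx.
    apply: H2_no_torsion_pred px => //; first by lia.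
    by have -> : n'.+1 = n by lia.
  have bE : b = e.+1 by lia.
  rewrite bE in le_ba sum_ab x nx px.
  have aE : a = n' - e.+1 by lia.
  rewrite aE in x nx px; case/eqP: nx.
  by apply: H2_no_torsion_small px => //; lia.
by case: i la_mu => [|[|[|i]]] //= [].
Qed.
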